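(* Let $G$ be a $2$-regular separable locally compact abelian group, $m$ a symplectic bicharacter of $G$, and $L\subset G$ a compact subgroup which is maximal isotropic for $m$. Let $W$ be an $m$-representation of $G$ on a Hilbert space $\mathcal{H}$ (not necessarily irreducible), and let $\mathcal{H}^L=\{\psi\in\mathcal{H} : W(a)\psi=\psi\ \forall a\in L\}$. If $L=2L$, then $W$ acts irreducibly on $\mathcal{H}$ if and only if $\dim(\mathcal{H}^L)=1$.
   Context: Groups are written additively; ''separable'' means second countable. $T=\{z\in\mathbf{C}:|z|=1\}$. A bicharacter of $G$ is a continuous map $m:G\times G\to T$ which is a character in each argument; it is alternating if $m(x,y)m(y,x)=1$ and $m(x,x)=1$ for all $x,y$, and symplectic if it is alternating and the induced morphism $\beta:G\to\widehat{G}$, $(x,\beta(y))=m(x,y)$, is an isomorphism. $G$ is $2$-regular if $x\mapsto 2x$ is a bijection of $G$; $2L=\{2a:a\in L\}$. A subgroup $A$ is isotropic for $m$ if $m\equiv 1$ on $A\times A$; maximal isotropic means maximal with respect to inclusion among isotropic subgroups. An $m$-representation of $G$ is a Borel map $W$ of $G$ into the unitary group of a Hilbert space with $W(0)=1$ and $W(x)W(y)=m(x,y)W(x+y)$. It is irreducible if its Hilbert space is nonzero and has no closed invariant subspaces other than $0$ and the whole space. *)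

(* Defs.v *)
From HB Require Import structures.
From mathcomp Require Import all_boot all_order all_algebra.
From mathcomp Require Import complex.
From mathcomp Require Import all_classical all_reals all_analysis.

Set Implicit Arguments.
Unset Strict Implicit.
Unset Printing Implicit Defensive.

Import Order.TTheory GRing.Theory Num.Theory.
Import numFieldNormedType.Exports.

Local Open Scope classical_set_scope.
Local Open Scope ring_scope.
Local Open Scope complex_scope.

(* The complex numbers are [R[i]] over [R : realType]; the alias [R[i]^o] is the one
   that carries their topology. *)

Section PontryaginDual.
Context {R : realType} {G : topologicalZmodType}.

(* The circle group is the set of complex numbers of norm 1, so a T-valued map
   is a complex-valued map of constant norm 1. *)
Definition characters : set {compact-open, G -> R[i]^o} :=
  [set chi | [/\ continuous (chi : G -> R[i]^o),
                 forall x, `|chi x| = 1 &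
                 forall x y, chi (x + y) = chi x * chi y]].

Lemma character_sval (chi : set_type characters) :
  characters (\val chi).
Proof. exact: set_valP. Qed.

Lemma characters1 : characters (fun=> 1).
Proof.
by split=> [|x|x y]; [exact: cst_continuous|rewrite normr1|rewrite mulr1].
Qed.

Lemma charactersM (chi psi : G -> R[i]^o) :
  characters chi -> characters psi -> characters (fun x => chi x * psi x).
Proof.
move=> [cc nc ac] [cp np ap]; split=> [x|x|x y].
- exact: (@continuousM R[i] G chi psi x (cc x) (cp x)).
- by rewrite normrM nc np mulr1.
- by rewrite ac ap mulrACA.
Qed.

Lemma charactersV (chi : G -> R[i]^o) :
  characters chi -> characters (fun x => chi (- x)).
Proof.
move=> [cc nc ac]; split=> [x|x|x y]; [|exact: nc|by rewrite opprD ac].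
by apply: continuous_comp; [exact: opp_continuous|exact: cc].
Qed.

End PontryaginDual.

(* The dual group, with the compact-open topology (the topology that
   [set_type] inherits from [{compact-open, G -> R[i]^o}]). *)
Definition pontryagin_dual (R : realType) (G : topologicalZmodType) : Type :=
  set_type (@characters R G).

HB.instance Definition _ (R : realType) (G : topologicalZmodType) :=
  Topological.copy (pontryagin_dual R G) (set_type (@characters R G)).

Section PontryaginDualGroup.
Context {R : realType} {G : topologicalZmodType}.
Local Notation dual := (pontryagin_dual R G).
Implicit Types chi psi : dual.

Definition dual_eval chi : G -> R[i]^o := \val chi.

Definition mk_dual (f : G -> R[i]^o) (fP : characters f) : dual :=
  SigSub (mem_set fP).

Lemma dual_evalP chi : characters (dual_eval chi).
Proof. exact: character_sval. Qed.

Lemma dual_inj chi psi : (forall x, dual_eval chi x = dual_eval psi x) ->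
  chi = psi.
Proof. by move=> e; apply/val_inj/funext. Qed.

(* The group law is pointwise multiplication, written additively. *)
Definition dual_zero : dual := mk_dual characters1.
Definition dual_opp chi : dual := mk_dual (charactersV (dual_evalP chi)).
Definition dual_add chi psi : dual :=
  mk_dual (charactersM (dual_evalP chi) (dual_evalP psi)).

Lemma dual_addA : associative dual_add.
Proof. by move=> a b c; apply: dual_inj => x; exact: mulrA. Qed.

Lemma dual_addC : commutative dual_add.
Proof. by move=> a b; apply: dual_inj => x; exact: mulrC. Qed.

Lemma dual_add0 : left_id dual_zero dual_add.
Proof. by move=> a; apply: dual_inj => x; exact: mul1r. Qed.

Lemma dual_addN : left_inverse dual_zero dual_opp dual_add.
Proof.
move=> a; apply: dual_inj => x.
have [_ na aa] := dual_evalP a.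
change (dual_eval a (- x) * dual_eval a x = 1); rewrite -aa addNr.
have a0 : dual_eval a 0 != 0 by rewrite -normr_eq0 na oner_neq0.
by apply: (mulfI a0); rewrite mulr1 -aa addr0.
Qed.

HB.instance Definition _ :=
  GRing.isZmodule.Build dual dual_addA dual_addC dual_add0 dual_addN.

End PontryaginDualGroup.

Definition topological_group_isomorphism (A B : PreTopologicalZmodule.type)
    (f : A -> B) : Prop :=
  [/\ zmod_morphism f, continuous f &
      exists g : B -> A, [/\ cancel f g, cancel g f & continuous g]].

Section Bicharacters.
Context {R : realType} {G : topologicalZmodType}.

Record bicharacter := Bicharacter {
  bichar_fun :> G -> G -> R[i]^o;
  bichar_continuous : continuous (fun p : G * G => bichar_fun p.1 p.2);
  bichar_norm : forall x y, `|bichar_fun x y| = 1;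
  bicharDl : forall x x' y,
    bichar_fun (x + x') y = bichar_fun x y * bichar_fun x' y;
  bicharDr : forall x y y',
    bichar_fun x (y + y') = bichar_fun x y * bichar_fun x y' }.

Implicit Type m : bicharacter.

Lemma bichar_character m x : characters (m x).
Proof.
split; [|exact: bichar_norm|exact: bicharDr] => y.
apply: (@continuous_comp _ _ _ (fun y => (x, y)) (fun p => m p.1 p.2)).
  by apply: cvg_pair; [exact: cvg_cst|exact: cvg_id].
exact: bichar_continuous.
Qed.

Definition induced_morphism m (x : G) : pontryagin_dual R G :=
  mk_dual (bichar_character m x).

Definition alternating m : Prop :=
  (forall x y, m x y * m y x = 1) /\ (forall x, m x x = 1).

Definition symplectic m : Prop :=
  alternating m /\ topological_group_isomorphism (induced_morphism m).

Definition isotropic m (A : set G) : Prop :=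
  forall x y, A x -> A y -> m x y = 1.

Definition maximal_isotropic m (A : set G) : Prop :=
  [/\ zmod_closed [in A], isotropic m A &
      forall B : set G, zmod_closed [in B] -> isotropic m B ->
        A `<=` B -> B = A].

End Bicharacters.

Arguments bicharacter R G : clear implicits.

Definition two_regular (G : zmodType) : Prop := bijective (fun x : G => x *+ 2).

Definition borel_map (X Y : topologicalType) (f : X -> Y) : Prop :=
  forall B : set Y, <<s (@open Y) >> B -> <<s (@open X) >> (f @^-1` B).

Section Representations.
Context {R : realType} {H : completeNormedModType R[i]}.

(* [dot] (linear in the first variable) is the inner product of H and the norm
   of H, for which H is complete, comes from it. *)
Definition hilbert_norm (dot : {dot H for Num.conj}) : Prop :=
  forall u : H, `|u| ^+ 2 = dot u u.

Variable dot : {dot H for Num.conj}.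

(* The unitary operators, as a subset of the space of all maps H -> H with the
   topology of pointwise convergence: [set_type unitary_group] is the unitary
   group with its strong operator topology. *)
Definition unitary_group : set {ptws H -> H} :=
  [set U | [/\ linear (U : H -> H),
               forall u v, dot (U u) (U v) = dot u v &
               forall v, exists u, U u = v]].

Definition unitary_op (U : set_type unitary_group) : H -> H := \val U.

Record mrepresentation (G : topologicalZmodType) (m : bicharacter R G) :=
  MRepresentation {
    mrep_fun :> G -> set_type unitary_group;
    mrep_borel : borel_map mrep_fun;
    mrep0 : unitary_op (mrep_fun 0) = id;
    mrepM : forall x y, unitary_op (mrep_fun x) \o unitary_op (mrep_fun y) =
      m x y \*: unitary_op (mrep_fun (x + y)) }.

Definition irreducible_mrep (G : topologicalZmodType) (m : bicharacter R G)
    (W : mrepresentation m) : Prop :=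
  (exists u : H, u != 0) /\
  forall V : set H, submod_closed [in V] -> closed V ->
    (forall x u, V u -> V (unitary_op (W x) u)) -> V = [set 0] \/ V = setT.

Definition fixed_vectors (G : topologicalZmodType) (m : bicharacter R G)
    (W : mrepresentation m) (L : set G) : set H :=
  [set u | forall a, L a -> unitary_op (W a) u = u].

End Representations.

Definition has_dim (K : fieldType) (E : lmodType K) (V : set E) (n : nat) :=
  exists e : 'I_n -> E,
    (forall c : 'I_n -> K, \sum_i c i *: e i = 0 -> forall i, c i = 0) /\
    V = [set \sum_i c i *: e i | c in [set: 'I_n -> K]].

(* Main.v *)
Require Import Defs.
From HB Require Import structures.
From mathcomp Require Import all_boot all_order all_algebra.
From mathcomp Require Import complex.
From mathcomp Require Import all_classical all_reals all_analysis.
From mathcomp Require Import ring lra.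

Import Order.TTheory GRing.Theory Num.Theory.
Import numFieldNormedType.Exports.

Local Open Scope classical_set_scope.
Local Open Scope ring_scope.
Local Open Scope complex_scope.

Set Implicit Arguments.
Unset Strict Implicit.
Unset Printing Implicit Defensive.

(** The idea.  As m is 1 on L, the operators W a with a in L form a unitary
    representation of the compact abelian group L, and for every x
        W a (W x u) = m(a, 2x) W x (W a u).
    So W x moves the eigenspace of L for a character chi to the eigenspace for
    m(., 2x) chi.  By maximality L is its own annihilator
    ([maximal_isotropic_annihilator]), and L = 2L turns this into: m(., 2x) is
    trivial on L only if x is in L.  Thus the eigenspaces of L are permuted
    simply transitively by G modulo L, and W is irreducible exactly when one
    of them, the space of fixed vectors, is a line.

    Concretely, everything rests on [exists_fixed_vector]: a nonzero closed
    invariant subspace V contains a nonzero L-fixed vector.  Given this, if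
    the fixed vectors form a line, then V and its orthogonal complement cannot
    both be nonzero, since both would contain that line.  Conversely, if u and
    v are orthogonal fixed vectors, all W x v are orthogonal to u: they equal
    v for x in L, and otherwise they belong to another character of L.  If W
    is irreducible and u is nonzero, the closed invariant subspace of the
    vectors orthogonal to all W x v contains u, so it is the whole space and
    v = 0 ([fixed_line_of_irreducible]).

    To find a fixed vector in V it is enough to find a common eigenvector w of
    L in V whose character has the form m(., y), for then W (- y/2) w is
    fixed.  These characters separate the points of L because the morphism of G
    to its dual is injective, so such a w is provided by a Peter-Weyl argument
    ([exists_eigenvector]).  That argument needs the orbit map a |-> W a v to
    be continuous on L, whereas W is only Borel and the Hilbert space may be
    nonseparable.

    Continuity ([borel_orbit_continuous]).  Let B be the set of the a in L
    with |W a v - v| < e.  For every subset A of L, the sumset A + B is the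
    preimage of a union of balls, so it is Borel.  If B were meager, a Cantor
    scheme would give a family (x_b), indexed by the infinite binary sequences
    b, with all differences outside B ([meager_continuum_separated]).  Then
    every subset of the family would be the trace of a Borel set, which is
    impossible by diagonalization, Borel sets being coded by such sequences
    ([not_all_traces_borel]).  So B is nonmeager with the Baire property, and
    B - B is a neighbourhood of 0 by Pettis's argument
    ([almost_open_difference]).

    Eigenvectors.  In place of Haar measure, averages over finitely supported
    means are used.  If the averages of chi(-a) W a v stay away from 0, the
    element of least norm in their closed hull is an eigenvector for chi
    ([eigenvector_of_nonnull]).  If they come close to 0 for every available
    chi, then g(a) <W a v, v> has averages close to 0 for each trigonometric
    polynomial g ([trig_null]); this fails when g is a high power of a
    polynomial with values in [0, 1] that peaks at 0
    ([exists_nonnull_character]). *)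

(** * Compact spaces: Baire category *)

Lemma continuous_pair (X Y Z : topologicalType) (f : X -> Y) (g : X -> Z) :
  continuous f -> continuous g -> continuous (fun x => (f x, g x)).
Proof. by move=> cf cg x; apply: cvg_pair; [exact: cf|exact: cg]. Qed.

Section CompactSpaces.
Context {T : topologicalType}.
Implicit Types (A B O : set T).

(** Compactness as an induction principle: what is hereditary, stable under
    finite unions and true near each point of A is true of A.  It replaces the
    extraction of finite subcovers. *)
Lemma compact_subadditive (A : set T) (P : set (set T)) :
  compact A -> P set0 -> (forall B C, P B -> P C -> P (B `|` C)) ->
  (forall B C, B `<=` C -> P C -> P B) ->
  (forall x, A x -> exists2 N, nbhs x N & P N) -> P A.
Proof.
move=> cA P0 PU PS Ploc; apply: contrapT => nPA.
pose F := filter_from P (fun N => A `\` N).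
have FF : ProperFilter F.
  apply: filter_from_proper.
    apply: filter_from_filter; first by exists set0.
    move=> B C PB PC; exists (B `|` C); first exact: PU.
    by move=> x [Ax nBC]; split; split=> // ?; apply: nBC; [left|right].
  move=> N PN; apply: contrapT => AN0; apply: nPA; apply: PS PN => x Ax.
  by apply: contrapT => Nx; apply: AN0; exists x.
have FA : F A by exists set0 => //; rewrite setD0.
have [x [Ax cx]] := cA F FF FA.
have [N xN PN] := Ploc x Ax.
have FN : F (A `\` N) by exists N.
by have [y [[_ nNy] /nNy]] := cx _ _ FN xN.
Qed.

Lemma compact_nested_closures (U : nat -> set T) : compact [set: T] ->
  (forall n, U n !=set0) -> (forall n, closure (U n.+1) `<=` U n) ->
  (\bigcap_n U n) !=set0.
Proof.
move=> cT U0 Uc.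
have Ule n k : U (n + k)%N `<=` U n.
  elim: k => [|k IH]; first by rewrite addn0.
  by rewrite addnS => x /subset_closure/Uc/IH.
pose F := filter_from [set: nat] U.
have FF : ProperFilter F.
  apply: filter_from_proper; last by move=> n _; exact: U0.
  apply: filter_from_filter; first by exists 0%N.
  move=> i j _ _; exists (i + j)%N => // x xU; split; first exact: Ule xU.
  by apply: (Ule j i); rewrite addnC.
have [x [_ cx]] := cT F FF filterT.
exists x => n _; apply: Uc => N xN; apply: cx => //.
by exists n.+1.
Qed.

Lemma compact_shrink_open O : hausdorff_space T -> compact [set: T] ->
  open O -> O !=set0 ->
  exists O', [/\ open O', O' !=set0 & closure O' `<=` O].
Proof.
move=> hT cT oO [x Ox].
have := compact_regular hT cT (filterT : nbhs x setT).
case/(_ _ O (open_nbhs_nbhs (conj oO Ox))) => B xB cB.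
exists B^°; split; first exact: open_interior.
  by exists x.
by apply: subset_trans cB; apply: closure_subset; exact: interior_subset.
Qed.

(** A set is meager when countably many closed sets with empty interior cover
    it; emptiness of the interior is density of the complement. *)
Definition meager B := exists F : nat -> set T,
  (forall n, closed (F n) /\ dense (~` F n)) /\ B `<=` \bigcup_n F n.

Lemma meager_sub A B : A `<=` B -> meager B -> meager A.
Proof. by move=> AB [F [FP BF]]; exists F; split=> //; exact: subset_trans BF. Qed.

Lemma meager_bigcup (B : nat -> set T) :
  (forall n, meager (B n)) -> meager (\bigcup_n B n).
Proof.
move=> /choice[F FP].
pose G k := if unpickle k is Some (n, i) then F n i else set0.
exists G; split.
  move=> k; rewrite /G; case: (unpickle k) => [[n i]|]; first by case: (FP n).
  split; first exact: closed0.
  by rewrite setC0 => O O0 _; rewrite setIT.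
move=> x [n _ Bx]; have [i _ Fx] := (FP n).2 _ Bx.
by exists (pickle (n, i)) => //; rewrite /G pickleK.
Qed.

Lemma meager_closed B : closed B -> dense (~` B) -> meager B.
Proof. by move=> cB dB; exists (fun=> B); split=> // x Bx; exists 0%N. Qed.

Lemma meager0 : meager set0.
Proof.
by apply: meager_closed; [exact: closed0|rewrite setC0 => O O0 _; rewrite setIT].
Qed.

Lemma meagerU A B : meager A -> meager B -> meager (A `|` B).
Proof.
move=> mA mB; rewrite -bigcup2E; apply: meager_bigcup => -[|[|n]] //=.
exact: meager0.
Qed.

(** Baire's theorem: shrink O repeatedly, avoiding one more of the covering
    closed sets at each stage, and use compactness. *)
Lemma compact_baire O : hausdorff_space T -> compact [set: T] ->
  open O -> O !=set0 -> ~ meager O.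
Proof.
move=> hT cT oO O0 [F [FP OF]].
pose good (U : set T) := open U /\ U !=set0.
have step (nU : nat * set T) : exists V, good nU.2 ->
    good V /\ closure V `<=` nU.2 `&` ~` F nU.1.
  case: nU => n U; case: (pselect (good U)) => [[oU U0]|nU]; last by exists set0.
  have [Fc Fd] := FP n.
  have o' : open (U `&` ~` F n) by apply: openI => //; exact: closed_openC.
  by have [V [oV V0 cV]] := compact_shrink_open hT cT o' (Fd _ U0 oU); exists V.
have [f fP] := choice step.
pose fix U n := if n is k.+1 then f (k, U k) else O.
have gU n : good (U n) by elim: n => //= n IH; have [] := fP (n, U n) IH.
have cU n : closure (U n.+1) `<=` U n `&` ~` F n.
  by have [] := fP (n, U n) (gU n).
have [|x Ux] := compact_nested_closures cT (fun n => (gU n).2).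
  by move=> n; exact: subset_trans (cU n) (@subIsetl _ _ _).
have [n _ Fx] := OF x (Ux 0%N I).
by have [_ []] := cU n x (subset_closure (Ux n.+1 I)).
Qed.

(** The Baire property: B differs from an open set by a meager set. *)
Definition almost_open B := exists2 O, open O & meager (B `+` O).

(** The complement of the closure of O is an open approximation of the
    complement of A, because the boundary of an open set is meager. *)
Lemma almost_openC A : almost_open A -> almost_open (~` A).
Proof.
move=> [ O oO mA]; exists (~` closure O).
  by apply: closed_openC; exact: closed_closure.
apply: (@meager_sub _ ((A `+` O) `|` (closure O `\` O))).
  move=> x; rewrite /setY /= => -[[nA]|[ncl nnA]].
    move/contrapT => cx; case: (pselect (O x)) => Ox; [left; right|right]; by [].
  left; left; split; last by move=> /subset_closure.
  exact: contrapT.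
apply: meagerU => //; apply: meager_closed.
  by apply: closedI; [exact: closed_closure|exact: open_closedC].
move=> U [x Ux] oU; case: (pselect (closure O x)) => [cx|ncx].
  have [y [Oy Uy]] := cx U (open_nbhs_nbhs (conj oU Ux)).
  by exists y; split=> // -[].
by exists x; split=> // -[].
Qed.

Lemma almost_open_bigcup (A : nat -> set T) :
  (forall n, almost_open (A n)) -> almost_open (\bigcup_n A n).
Proof.
move=> aA.
have /choice[ O OP] : forall n, exists O, open O /\ meager (A n `+` O).
  by move=> n; have [ O] := aA n; exists O.
exists (\bigcup_n O n); first by apply: bigcup_open => n _; case: (OP n).
apply: meager_sub (meager_bigcup (fun n => (OP n).2)).
move=> x [[[n _ Ax] nO]|[[n _ Ox] nA]]; exists n => //.
  by left; split=> // Ox; apply: nO; exists n.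
by right; split=> // Ax; apply: nA; exists n.
Qed.

Lemma borel_almost_open B : <<s (@open T) >> B -> almost_open B.
Proof.
apply: smallest_sub => [|O oO]; last by exists O; rewrite ?setYK //; exact: meager0.
split.
- by exists set0; [exact: open0|rewrite setYK; exact: meager0].
- by move=> A aA; rewrite setTD; exact: almost_openC.
- exact: almost_open_bigcup.
Qed.

(** Codes for Borel sets.  A code is a labelling of finite sequences, read as
    a tree: label k+1 is a leaf standing for the basic open set U k, and label
    0 is a node standing for the complement of the union of its children.
    Complements of unions generate both Boolean operations, so one kind of
    node is enough. *)
Inductive borel_code (U : nat -> set T) : (seq nat -> nat) -> set T -> Prop :=
| code_basic c k : c [::] = k.+1 -> borel_code U c (U k)
| code_node c (E : nat -> set T) : c [::] = 0%N ->
    (forall n, borel_code U (fun s => c (n :: s)) (E n)) ->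
    borel_code U c (~` \bigcup_n E n).

Lemma borel_code_inj U c E E' : borel_code U c E -> borel_code U c E' -> E = E'.
Proof.
move=> cE; elim: cE E' => {c E} [c k ck|c E c0 _ IH] E' cE'.
  by case: _ _ / cE' ck => [c' k' -> []->|c' ? ->].
case: _ _ / cE' c0 IH => [c' k' -> //|c' F _ cF _ IH].
by congr (~` _); apply: eq_bigcupr => n _; exact: IH.
Qed.

Lemma borel_has_code (U : nat -> set T) :
  (forall O, open O -> exists D : set nat, O = \bigcup_(k in D) U k) ->
  (exists k, U k = set0) ->
  forall E, <<s (@open T) >> E -> exists c, borel_code U c E.
Proof.
move=> Ubasis [k0 Uk0].
have codeN (E : nat -> set T) : (forall n, exists c, borel_code U c (E n)) ->
    exists c, borel_code U c (~` \bigcup_n E n).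
  move=> /choice[c cE].
  by exists (fun s => if s is n :: s' then c n s' else 0%N); apply: code_node.
have codeC E : (exists c, borel_code U c E) -> exists c, borel_code U c (~` E).
  by move=> cE; rewrite -(@bigcup_const _ _ [set: nat] E); [apply: codeN|exists 0%N].
have codeU (E : nat -> set T) : (forall n, exists c, borel_code U c (E n)) ->
    exists c, borel_code U c (\bigcup_n E n).
  by move=> /codeN/codeC; rewrite setCK.
have codeB k : exists c, borel_code U c (U k).
  by exists (fun=> k.+1); exact: (@code_basic U (fun=> k.+1) k).
suff sub : <<s (@open T) >> `<=` [set E | exists c, borel_code U c E].
  by move=> E /sub.
apply: smallest_sub => [|O /Ubasis[D ->]] /=.
  split=> [|A cA|A cA]; [by rewrite -Uk0|by rewrite setTD; exact: codeC|exact: codeU].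
rewrite bigcup_mkcond; apply: codeU => n; case: ifPn => _ //.
by rewrite -Uk0.
Qed.

(** The empty set is included among the basic open sets so that the unions
    indexed by D can be turned into countable unions over nat. *)
Lemma second_countable_enum : @second_countable T ->
  exists U : nat -> set T, (exists k, U k = set0) /\
  forall O, open O -> exists D : set nat, O = \bigcup_(k in D) U k.
Proof.
move=> [B /pfcard_geP[B0|[f]] [Bo Bb]].
  exists (fun=> set0); split=> [|O oO]; first by exists 0%N.
  exists set0; rewrite bigcup_set0 -subset0 => x Ox.
  by have [N [+ _]] := Bb x _ (open_nbhs_nbhs (conj oO Ox)); rewrite B0.
exists (fun n => if n is k.+1 then f k else set0); split; first by exists 0%N.
move=> O oO; exists [set k | if k is k'.+1 then f k' `<=` O else True].
apply/seteqP; split=> [x Ox|x [[|k] //= fO /fO //]].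
have [N [BN Nx] NO] := Bb x _ (open_nbhs_nbhs (conj oO Ox)).
have [k _ fk] := 'surj_f BN.
by exists k.+1; rewrite /= ?fk.
Qed.

(** Cantor's diagonal argument: Borel codes embed into binary sequences, so
    the set S of those sequences b that code a Borel set not containing x b
    cannot be the trace of a Borel set on the family x. *)
Lemma not_all_traces_borel (x : (nat -> bool) -> T) :
  @second_countable T ->
  ~ (forall S : set (nat -> bool), exists2 E, <<s (@open T) >> E &
       forall b, E (x b) <-> S b).
Proof.
move=> /second_countable_enum[U [U0 Ub]] xS.
pose code_of (c : seq nat -> nat) : nat -> bool :=
  fun n => if unpickle n is Some (s, k) then c s == k else false.
have code_of_inj c c' : code_of c = code_of c' -> c = c'.
  move=> cc'; apply/funext => s; have := congr1 (@^~ (pickle (s, c s))) cc'.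
  by rewrite /code_of pickleK eqxx => /esym/eqP.
pose S b := exists c E, [/\ b = code_of c, borel_code U c E & ~ E (x b)].
have [E bE ES] := xS S.
have [c cE] := borel_has_code Ub U0 bE.
have [SE ES'] : (S (code_of c) -> E (x (code_of c))) /\
    (E (x (code_of c)) -> S (code_of c)).
  by split=> /ES.
have nE : ~ E (x (code_of c)).
  move=> Ex; have [c' [E' [/code_of_inj<- cE' nE']]] := ES' Ex.
  by apply: nE'; rewrite (borel_code_inj cE' cE).
by apply: (nE); apply: SE; exists c, E.
Qed.

End CompactSpaces.
(** * Compact groups: automatic continuity *)
Section CompactGroups.
Context {K : topologicalZmodType}.
Hypothesis hK : hausdorff_space K.
Hypothesis cK : compact [set: K].
Implicit Types (A B O U V F : set K).

Lemma open_shift (a : K) O : open O -> open [set x | O (x + a)].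
Proof.
move=> oO; apply: (@open_comp _ _ (fun x : K => x + a)) => // x _.
apply: (@continuous_comp _ _ _ (fun x => (x, a)) (fun p : K * K => p.1 + p.2)).
  by apply: cvg_pair; [exact: cvg_id|exact: cvg_cst].
exact: add_continuous.
Qed.

Lemma closed_shift (a : K) F : closed F -> closed [set x | F (x + a)].
Proof.
move=> cF; rewrite -openC.
exact: (@open_shift a (~` F)) (closed_openC cF).
Qed.

Lemma meager_shift (a : K) B : meager B -> meager [set x | B (x + a)].
Proof.
move=> [F [FP BF]]; exists (fun n => [set x | F n (x + a)]); split; last first.
  by move=> x /BF[n _ Fx]; exists n.
move=> n; have [Fc Fd] := FP n; split; first exact: closed_shift.
move=> O [x Ox] oO.
have [y [Oy nFy]] : [set x | O (x - a)] `&` ~` F n !=set0.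
  by apply: Fd; [exists (x + a); rewrite /= addrK|exact: open_shift].
by exists (y - a); split=> //=; rewrite subrK.
Qed.

(** Some difference u - v with u in U and v in V avoids F because F has empty
    interior; by continuity so do all differences of nearby points. *)
Lemma separate_pair F U V : closed F -> dense (~` F) ->
  open U -> U !=set0 -> open V -> V !=set0 ->
  exists U' V', [/\ open U' /\ U' !=set0, open V' /\ V' !=set0,
    U' `<=` U, V' `<=` V & forall x y, U' x -> V' y -> ~ F (x - y)].
Proof.
move=> cF dF oU [u Uu] oV [v Vv].
have [w [/= Uw nFw]] : [set x | U (x + v)] `&` ~` F !=set0.
  by apply: dF; [exists (u - v); rewrite /= subrK|exact: open_shift].
have : nbhs (w + v, v) [set p : K * K | ~ F (p.1 - p.2)].
  apply: (@sub_continuous K (w + v, v) (~` F)).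
  by apply: open_nbhs_nbhs; split; [exact: closed_openC|rewrite /= addrK].
move=> [[P Q] /= [wP vQ] PQ].
exists (P^° `&` U), (Q^° `&` V); split.
- split; first by apply: openI => //; exact: open_interior.
  by exists (w + v); split.
- split; first by apply: openI => //; exact: open_interior.
  by exists v; split.
- exact: subIsetr.
- exact: subIsetr.
- by move=> x y [/interior_subset Px _] [/interior_subset Qy _]; apply: (PQ (x, y)).
Qed.

Lemma separate_family (I : eqType) (F : nat -> set K) (U : I -> set K)
    (s : seq (I * I * nat)) :
  (forall n, closed (F n) /\ dense (~` F n)) ->
  (forall i, open (U i) /\ U i !=set0) ->
  exists V : I -> set K, [/\ forall i, open (V i) /\ V i !=set0,
    forall i, V i `<=` U i &
    forall i j k, (i, j, k) \in s -> i != j ->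
      forall x y, V i x -> V j y -> ~ F k (x - y)].
Proof.
move=> FP UP; elim: s => [|[[i j] k] s [V [VP VU Vs]]].
  by exists U; split=> // i; exact: subset_refl.
case: (eqVneq i j) => [<-|ij].
  exists V; split=> // i' j' k'; rewrite in_cons => /orP[/eqP[-> -> _]|].
    by rewrite eqxx.
  exact: Vs.
have [Fc Fd] := FP k; have [oi i0] := VP i; have [oj j0] := VP j.
have [Vi [Vj [Vi0 Vj0 ViV VjV nF]]] := separate_pair Fc Fd oi i0 oj j0.
pose W l := if l == i then Vi else if l == j then Vj else V l.
have WV l : W l `<=` V l.
  by rewrite /W; case: eqVneq => [->|_] //; case: eqVneq => [->|_].
exists W; split.
- by move=> l; rewrite /W; case: ifP => // _; case: ifP.
- by move=> l; exact: subset_trans (WV l) (VU l).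
- move=> i' j' k'; rewrite in_cons => /orP[/eqP[-> -> ->] _ x y|].
    by rewrite /W !eqxx eq_sym (negPf ij); exact: nF.
  by move=> /Vs/[apply] H x y /WV Wx /WV; exact: H.
Qed.

(** Mycielski's construction.  Nonempty open sets U n s, for binary words s of
    length n, are chosen so that the closures of the sets of level n+1 lie in
    their parents, and points of distinct sets of level n+1 have a difference
    outside the first n+1 of the closed sets covering B.  Words grow at their
    head, so that the word of length n of a sequence is its reversed prefix. *)
Lemma meager_continuum_separated B : meager B ->
  exists x : (nat -> bool) -> K, forall b c, b <> c -> ~ B (x b - x c).
Proof.
move=> [F [FP BF]].
pose good (U : seq bool -> set K) := forall s, open (U s) /\ U s !=set0.
have step (nU : nat * (seq bool -> set K)) :
    exists V : seq bool -> set K, good nU.2 ->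
    [/\ good V, forall b s, closure (V (b :: s)) `<=` nU.2 s &
      forall s t k, size s = nU.1.+1 -> size t = nU.1.+1 -> (k <= nU.1)%N ->
        s != t -> forall x y, V s x -> V t y -> ~ F k (x - y)].
  case: nU => n U /=; case: (pselect (good U)) => [gU|nU]; last by exists U.
  have /choice[V VP] : forall s, exists O',
      [/\ open O', O' !=set0 & closure O' `<=` U (behead s)].
    by move=> s; have [oU U0] := gU (behead s); exact: compact_shrink_open.
  pose bits := [seq tval t | t <- enum {: n.+1.-tuple bool}].
  have bitsP s : size s = n.+1 -> s \in bits.
    move=> /eqP sn; apply/mapP; exists (Tuple sn) => //; exact: mem_enum.
    (* all pairs of words of length n+1, with each of the first n+1 closed sets *)
pose l := [seq (p, k) | p <- [seq (s, t) | s <- bits, t <- bits], k <- iota 0 n.+1].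
  have VP' s : open (V s) /\ V s !=set0 by have [] := VP s.
  have [W [WP WV Wl]] := separate_family l FP VP'.
  exists W => _; split=> //.
    move=> b s; have [_ _ cV] := VP (b :: s).
    by apply: subset_trans cV; apply: closure_subset; exact: WV.
  move=> s t k ss st kn; apply: Wl; apply/allpairsP; exists ((s, t), k).
  split=> //; last by rewrite mem_iota add0n ltnS.
  by apply/allpairsP; exists (s, t); split=> //=; exact: bitsP.
have [f fP] := choice step.
pose fix U n := if n is k.+1 then f (k, U k) else fun=> [set: K].
have gU n : good (U n).
  elim: n => [s|n IH] /=; first by split; [exact: openT|exists 0].
  by have [] := fP (n, U n) IH.
pose pre (b : nat -> bool) n := rev (mkseq b n).
have preS b n : pre b n.+1 = b n :: pre b n.
  by rewrite /pre /mkseq -addn1 iotaD map_cat rev_cat.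
have size_pre b n : size (pre b n) = n by rewrite size_rev size_mkseq.
have xP b : (\bigcap_n U n (pre b n)) !=set0.
  apply: (compact_nested_closures cK) => n; first by have [] := gU n (pre b n).
  by rewrite preS; have [_ + _] := fP (n, U n) (gU n); apply.
exists (fun b => sval (cid (xP b))) => b c bc /BF[k _].
case: cid => x xb; case: cid => y yc /=.
have [i bci] : exists i, b i != c i.
  by apply: contrapT => /forallNP H; apply: bc; apply/funext => i; apply/eqP/negPn/negP/H.
(* a level at which b and c are separated and at which F k is avoided *)
pose n := maxn i k.
have [_ _ H] := fP (n, U n) (gU n).
apply: (H (pre b n.+1) (pre c n.+1)); rewrite ?size_pre //.
- exact: leq_maxr.
- apply/eqP => /(congr1 (fun s => nth false (rev s) i)); rewrite !revK.
  by rewrite !nth_mkseq ?ltnS ?leq_maxl // => /eqP; apply/negP.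
- exact: (xb n.+1 I).
- exact: (yc n.+1 I).
Qed.

(** Otherwise take x as in the previous lemma.  As no x b - x c lies in B for
    b distinct from c, the sumset of x @` S and B meets the family exactly in
    S, so that every S would be the trace of a Borel set. *)
Lemma borel_sumsets_nonmeager B : @second_countable K -> B 0 ->
  (forall A, <<s (@open K) >> [set a + b | a in A & b in B]) -> ~ meager B.
Proof.
move=> sK B0 BA mB; have [x xP] := meager_continuum_separated mB.
apply: (not_all_traces_borel sK) => S.
exists [set a + b | a in x @` S & b in B]; first exact: BA.
move=> b; split=> [[_ [c Sc <-] [d Bd]]|Sb].
  case: (pselect (b = c)) => [->//|bc] e.
  case: (xP _ _ bc).
  have -> // : x b - x c = d by apply: (addrI (x c)); rewrite addrC subrK e.
by exists (x b); [exists b|exists 0 => //; rewrite addr0].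
Qed.

(** Pettis: if B is O up to a meager set, then for a small the sets O and
    O - a overlap in a nonempty open set, and by Baire's theorem some y of it
    lies in B together with y + a. *)
Lemma almost_open_difference B : almost_open B -> ~ meager B ->
  nbhs 0 [set a - b | a in B & b in B].
Proof.
move=> [ O oO mBO] nmB.
have [x Ox] : O !=set0.
  apply: contrapT => /nonemptyPn O0; apply: nmB; apply: meager_sub mBO.
  by rewrite O0 setY0.
have : nbhs 0 [set a | O (x + a)].
  have : open [set a | O (a + x)] by exact: open_shift.
  under eq_set do rewrite addrC.
  by move=> oa; apply: open_nbhs_nbhs; split=> //=; rewrite addr0.
apply: filterS => a Oxa.
pose N := B `+` O.
have [y [Oy [Oya [nNy nNya]]]] : exists y, O y /\ O (y + a) /\ ~ N y /\ ~ N (y + a).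
  apply: contrapT => /forallNP none.
  apply: (@compact_baire K (O `&` [set y | O (y + a)])) => //.
  - by apply: openI => //; exact: open_shift.
  - by exists x.
  - apply: meager_sub (meagerU mBO (meager_shift a mBO)) => y [Oy Oya].
    apply: contrapT => /not_orP[nN nNa]; exact: (none y).
have inB z : O z -> ~ N z -> B z by move=> Oz nN; apply: contrapT => nB; apply: nN; right.
by exists (y + a); [exact: inB|exists y; [exact: inB|rewrite addrAC subrr add0r]].
Qed.

End CompactGroups.
(** No separability of H is assumed, so it is essential that preimages of all
    open sets are Borel: the regular representation of K made discrete has
    orbits that are discontinuous although each of its coefficients is Borel
    measurable. *)
Lemma borel_orbit_continuous (F : numFieldType) (H : normedModType F)
    (K : topologicalZmodType) (T : K -> H -> H) (v : H) :
  hausdorff_space K -> compact [set: K] -> @second_countable K ->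
  (forall a b u, T (a + b) u = T a (T b u)) ->
  (forall a u w, `|T a u - T a w| = `|u - w|) ->
  T 0 v = v ->
  (forall O, open O -> <<s (@open K) >> ((fun a => T a v) @^-1` O)) ->
  continuous (fun a => T a v).
Proof.
move=> hK cK sK TD Tiso T0 Tborel.
have Tdist a b : `|T a v - T b v| = `|T (a - b) v - v|.
  by rewrite -[LHS](Tiso (- b)) -!TD addNr T0 [- b + a]addrC.
have near0 e : 0 < e -> nbhs (0 : K) [set a | `|T a v - v| < e].
  move=> e0; pose B := [set a | `|T a v - v| < e / 2].
  have BA A : <<s (@open K) >> [set a + b | a in A & b in B].
    have -> : [set a + b | a in A & b in B] =
        (fun x => T x v) @^-1` (\bigcup_(a in A) ball (T a v) (e / 2)).
      apply/seteqP; split=> [_ [a Aa [b Bb <-]]|x [a Aa]].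
        exists a => //; rewrite -ball_normE /ball_ /= distrC Tdist.
        by rewrite addrAC subrr add0r.
      rewrite -ball_normE /ball_ /= distrC Tdist => Bxa.
      by exists a => //; exists (x - a) => //; rewrite addrC subrK.
    by apply: Tborel; apply: bigcup_open => a _; exact: ball_open.
  have B0 : B 0 by rewrite /B /= T0 subrr normr0 divr_gt0.
  have bB : <<s (@open K) >> B.
    suff -> : B = [set a + b | a in [set 0] & b in B] by exact: BA.
    apply/seteqP; split=> [b Bb|_ [_ -> [b Bb <-]]]; last by rewrite add0r.
    by exists 0 => //; exists b => //; rewrite add0r.
  have := almost_open_difference hK cK (borel_almost_open bB)
    (borel_sumsets_nonmeager hK cK sK B0 BA).
  apply: filterS => _ [a Ba [b Bb <-]] /=; rewrite -Tdist.
  rewrite -[T a v](subrK v) -addrA (le_lt_trans (ler_normD _ _)) //.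
  by rewrite [ltRHS]splitr ltrD // distrC.
move=> a; apply/cvgrPdist_lt => e /near0 e0.
have := @sub_continuous K (a, a); rewrite /continuous_at /= subrr => /(_ _ e0).
move=> [[P Q] /= [aP aQ] PQ].
apply: filterS aQ => b Qb; rewrite Tdist.
by apply: (PQ (a, b)); split=> //; exact: nbhs_singleton.
Qed.
(** * Hilbert spaces: least norm and orthogonality *)
Section LinearPredicate.
Context {F : pzRingType} {E E' : lmodType F} {U : E -> E'}.
Hypothesis Ulin : linear U.

Lemma linear_morphD : {morph U : u w / u + w}.
Proof. by move=> u w; have := Ulin 1 u w; rewrite !scale1r. Qed.

Lemma linear_morphZ c u : U (c *: u) = c *: U u.
Proof.
have U0 : U 0 = 0 by apply: (addIr (U 0)); rewrite -linear_morphD !add0r.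
by have := Ulin c u 0; rewrite U0 !addr0.
Qed.

Lemma linear_morphB u w : U (u - w) = U u - U w.
Proof. by rewrite linear_morphD -[- w]scaleN1r linear_morphZ scaleN1r. Qed.

End LinearPredicate.

Section Hilbert.
Context {R : realType} {H : completeNormedModType R[i]}.
Variable dot : {dot H for Num.conj}.
Hypothesis hilbertH : hilbert_norm dot.
Implicit Types u v w : H.
Local Notation "''[' u , v ]" := (dot u v) : ring_scope.

Lemma dotDl u v w : '[u + v, w] = '[u, w] + '[v, w].
Proof. by rewrite linearDl. Qed.
Lemma dotDr u v w : '[w, u + v] = '[w, u] + '[w, v].
Proof. by rewrite linearDr. Qed.
Lemma dotBl u v w : '[u - v, w] = '[u, w] - '[v, w].
Proof. by rewrite linearBl. Qed.
Lemma dotNl u w : '[- u, w] = - '[u, w].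
Proof. by rewrite linearNl. Qed.
Lemma dotNr u w : '[w, - u] = - '[w, u].
Proof. by rewrite linearNr. Qed.
Lemma dotZl a u v : '[a *: u, v] = a * '[u, v].
Proof. by rewrite linearZl_LR. Qed.
Lemma dotZr a u v : '[u, a *: v] = Num.conj a * '[u, v].
Proof. by rewrite linearZr_LR. Qed.
Lemma dotC u v : '[u, v] = Num.conj '[v, u].
Proof. by rewrite hermC expr0 mul1r. Qed.
Lemma dotuu u : '[u, u] = `|u| ^+ 2. Proof. by rewrite hilbertH. Qed.

Lemma isometry_norm (U : H -> H) u :
  (forall u w, '[U u, U w] = '[u, w]) -> `|U u| = `|u|.
Proof. by move=> iU; apply/eqP; rewrite -(@eqrXn2 _ 2) // -!dotuu iU. Qed.

Lemma parallelogram u v :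
  `|u + v| ^+ 2 + `|u - v| ^+ 2 = (`|u| ^+ 2 + `|v| ^+ 2) *+ 2.
Proof.
by rewrite -!dotuu !(dotDl, dotDr) !(dotNl, dotNr) opprK; ring.
Qed.

(** Orthogonal projection on the line of v. *)
Lemma dot_sub_proj u v : v != 0 -> '[u - ('[u, v] / '[v, v]) *: v, v] = 0.
Proof.
move=> v0; rewrite dotBl dotZl divfK ?subrr //.
by rewrite dotuu expf_neq0 // normr_eq0.
Qed.

Lemma cauchy_schwarz u v : `|'[u, v]| <= `|u| * `|v|.
Proof.
have [->|v0] := eqVneq v 0; first by rewrite linear0r !normr0 mulr0.
have vv : 0 < `|v| ^+ 2 by rewrite exprn_gt0 // normr_gt0.
set c := '[u, v] / '[v, v].
have e : '[u, u] = '[u - c *: v, u - c *: v] + '[c *: v, c *: v].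
  have o := dot_sub_proj u v0; rewrite -/c in o.
  have o' : '[u - c *: v, c *: v] = 0 by rewrite dotZr o mulr0.
  have o'' : '[c *: v, u - c *: v] = 0 by rewrite dotC o' conjC0.
  rewrite -[u in LHS](subrK (c *: v) u); move: o' o''; move: (u - _) => w o' o''.
  by rewrite dotDl !dotDr o' o'' addr0 add0r.
have : `|c *: v| ^+ 2 <= `|u| ^+ 2.
  by rewrite -(dotuu u) e !dotuu lerDr exprn_ge0.
rewrite ler_sqr ?nnegrE // normrZ normrM normfV dotuu normrX normr_id => h.
rewrite -(ler_pM2r (_ : 0 < `|v|^-1)) ?invr_gt0 ?normr_gt0 //.
rewrite mulfK ?normr_eq0 //; apply: le_trans h.
by rewrite expr2 invfM !mulrA mulfVK ?normr_eq0.
Qed.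

Lemma dot_continuousl v : continuous (fun u => '[u, v] : R[i]^o).
Proof.
move=> u; apply/cvgrPdist_lt => e e0.
have v0 : 0 < `|v| + 1 by rewrite ltr_wpDl.
have : \forall u' \near u, `|u - u'| < e / (`|v| + 1).
  have := nbhsx_ballx u (e / (`|v| + 1)) (divr_gt0 e0 v0).
  by rewrite -ball_normE.
apply: filterS => u' uu'; rewrite -dotBl.
apply: le_lt_trans (cauchy_schwarz _ _) _.
apply: (@le_lt_trans _ _ (`|u - u'| * (`|v| + 1))).
  by rewrite ler_wpM2l // lerDl.
by rewrite -ltr_pdivlMr.
Qed.

Lemma closed_orthogonal v : closed [set u | '[u, v] = 0].
Proof.
apply: (@closed_comp _ _ (fun u => '[u, v] : R[i]^o) [set 0]).
  by move=> u _; exact: dot_continuousl.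
exact: (accessible_closed_set1 (hausdorff_accessible (@norm_hausdorff _ R[i]^o))) 0.
Qed.

(** The norm of H takes its values in R[i]; infima are taken in R. *)
Let nrm (u : H) : R := complex.Re `|u|.

Let nrmE u : `|u| = (nrm u)%:C.
Proof. by rewrite /nrm RRe_real // ger0_real. Qed.

(** By the parallelogram identity, vectors of C of almost minimal norm are
    close to one another, since their midpoint is again in C; hence the
    filter of these vectors is Cauchy.  It is enough to
    control midpoints, and the averages over dyadic means are stable under
    them. *)
Lemma min_norm (C : set H) : C !=set0 -> closed C ->
  (forall u v, C u -> C v -> C (2^-1 *: (u + v))) ->
  exists2 p, C p & forall u, C u -> `|p| <= `|u|.
Proof.
move=> [u0 Cu0] cC midC.
pose d := inf [set nrm u | u in C].
have nrm_ge0 u : 0 <= nrm u by rewrite -(ler0c (nrm u)) -nrmE.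
have hinf : has_inf [set nrm u | u in C].
  by split; [exists (nrm u0), u0|exists 0 => _ [u _ <-]].
have d_le u : C u -> d <= nrm u.
  by move=> Cu; apply: ge_inf; [case: hinf|exists u].
have d0 : 0 <= d by apply: lb_le_inf; [case: hinf|move=> _ [u _ <-]].
have near_d e : 0 < e -> exists2 u, C u & nrm u < d + e.
  by move=> e0; have [_ [u Cu <-] ue] := inf_adherent e0 hinf; exists u.
have close u v e : 0 < e -> C u -> C v -> nrm u < d + e -> nrm v < d + e ->
    nrm (u - v) ^+ 2 <= 8 * d * e + 4 * e ^+ 2.
  move=> e0 Cu Cv ue ve.
  have : nrm (u + v) ^+ 2 + nrm (u - v) ^+ 2 = (nrm u ^+ 2 + nrm v ^+ 2) *+ 2.
    apply: complexI; rewrite rmorphMn !rmorphD !rmorphXn /= -!nrmE.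
    exact: parallelogram.
  have : 2 * d <= nrm (u + v).
    have := d_le _ (midC _ _ Cu Cv); rewrite -lecR -nrmE normrZ nrmE.
    have -> : `|2^-1 : R[i]| = (2^-1)%:C by rewrite ger0_norm // fmorphV rmorph_nat.
    by rewrite -rmorphM lecR mulrC ler_pdivlMr // mulrC.
  have := d_le u Cu; have := d_le v Cv; have := nrm_ge0 (u + v).
  by nra.
pose F := filter_from [set e : R | 0 < e] (fun e => C `&` [set u | nrm u < d + e]).
have FF : ProperFilter F.
  apply: filter_from_proper; last first.
    by move=> e /near_d[u Cu ue]; exists u.
  apply: filter_from_filter; first by exists 1 => /=.
  move=> i j i0 j0; exists (Num.min i j); first by rewrite /= lt_min i0.
  move=> u [Cu /= uij]; split; split=> //=; apply: lt_le_trans uij _;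
    by rewrite lerD2l ge_min lexx ?orbT.
have /cauchy_cvgP : cauchy F.
  apply/cauchyP => /= e e0.
  have eE : e = (complex.Re e)%:C by rewrite RRe_real // ger0_real // ltW.
  move: e0; rewrite eE ltcR => {eE}; set r := complex.Re e => r0.
  (* solves t (8 d + 4 + r^2) = r^2, whence 8 d t + 4 t^2 < r^2 *)
  pose t := r ^+ 2 / (8 * d + 4 + r ^+ 2).
  have den0 : 0 < 8 * d + 4 + r ^+ 2 by have := exprn_gt0 2 r0; lra.
  have t0 : 0 < t by rewrite divr_gt0 // exprn_gt0.
  have tE : t * (8 * d + 4 + r ^+ 2) = r ^+ 2 by rewrite divfK // gt_eqF.
  have [u Cu ut] := near_d t t0.
  exists u, t => // v [Cv /= vt]; rewrite -ball_normE /ball_ /= nrmE ltcR.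
  have /= uv := close u v t t0 Cu Cv ut vt.
  rewrite -(ltr_pXn2r (n := 2)) // ?nnegrE ?nrm_ge0 ?ltW //.
  apply: le_lt_trans uv _.
  have t1 : t < 1 by rewrite ltr_pdivrMr // mul1r; lra.
  have r20 := exprn_gt0 2 r0.
  by rewrite -[ltRHS]tE; nra.
move=> /cvg_ex[p Fp]; exists p.
  apply: cC => N /Fp[e e0 eN].
  by have [u Cu ue] := near_d e e0; exists u; split=> //; exact: eN.
move=> u Cu; rewrite !nrmE lecR; apply: le_trans (d_le u Cu).
apply/ler_addgt0Pr => e e0; have e20 : 0 < e / 2 by rewrite divr_gt0.
have : nbhs p (ball p (e / 2)%:C) by apply: nbhsx_ballx; rewrite ltcR.
move=> /Fp[t t0 tp].
have [w Cw wt] : exists2 w, C w & nrm w < d + Num.min t (e / 2).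
  by apply: near_d; rewrite lt_min t0.
have : ball p (e / 2)%:C w.
  by apply: tp; split=> //=; apply: lt_le_trans wt _; rewrite lerD2l ge_min lexx.
rewrite -ball_normE /ball_ /= nrmE ltcR => pw.
have : nrm p <= nrm (p - w) + nrm w.
  by rewrite -lecR rmorphD /= -!nrmE -[X in `|X| <= _](subrK w) ler_normD.
have : Num.min t (e / 2) <= e / 2 by rewrite ge_min lexx orbT.
by lra.
Qed.

(** The equality case of the parallelogram identity. *)
Lemma min_norm_unique (p q : H) :
  `|p| = `|q| -> `|p| <= `|2^-1 *: (p + q)| -> p = q.
Proof.
move=> pq; rewrite normrZ normfV normr_nat mulrC ler_pdivlMr // => le2.
have := parallelogram p q; rewrite -pq => par.
have le4 : (`|p| * 2) ^+ 2 <= `|p + q| ^+ 2.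
  by rewrite ler_pXn2r // nnegrE ?mulr_ge0.
apply/eqP; rewrite -subr_eq0 -normr_eq0 -sqrf_eq0 eq_le exprn_ge0 // andbT.
have -> : `|p - q| ^+ 2 = (`|p| * 2) ^+ 2 - `|p + q| ^+ 2.
  by apply/eqP; rewrite eq_sym subr_eq addrC par; apply/eqP; ring.
by rewrite subr_le0.
Qed.

(** The vector of least norm in a coset of V is orthogonal to V. *)
Lemma orthogonal_vector (V : set H) : submod_closed [in V] -> closed V ->
  V <> setT -> exists2 w, w != 0 & forall u, V u -> '[w, u] = 0.
Proof.
move=> [V0 Vlin] cV VT.
have Vadd a u v : V u -> V v -> V (a *: u + v).
  by move=> Vu Vv; have := Vlin a u v; rewrite !inE; apply.
have {}V0 : V 0 by move: V0; rewrite inE.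
have [v nVv] : exists v, ~ V v.
  apply: contrapT => /forallNP nV; apply: VT; apply/seteqP; split=> // x _.
  by apply: contrapT; exact: nV.
pose C := [set u | V (v - u)].
have cC : closed C.
  apply: (@closed_comp _ _ (fun u : H => v - u) V) => // u _.
  apply: (@continuous_comp _ _ _ (fun u : H => (v, u)) (fun p : H * H => p.1 - p.2)).
    by apply: cvg_pair; [exact: cvg_cst|exact: cvg_id].
  exact: sub_continuous.
have [||p Cp pmin] := min_norm _ cC.
- by exists v; rewrite /C /= subrr.
- move=> u w Cu Cw; rewrite /C /=.
  have -> : v - 2^-1 *: (u + w) = 2^-1 *: (v - u) + (2^-1 *: (v - w) + 0).
    have {1}-> : v = 2^-1 *: v + 2^-1 *: v.
      by rewrite -scalerDl -{1 2}[2^-1]mul1r -splitr scale1r.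
    by rewrite addr0 !scalerBr scalerDr opprD addrACA.
  by apply: (Vadd) => //; apply: (Vadd).
exists p; first by apply/eqP => p0; apply: nVv; move: Cp; rewrite p0 /C /= subr0.
move=> u Vu; have [->|u0] := eqVneq u 0; first by rewrite linear0r.
set c := '[p, u] / '[u, u].
have Cq : C (p - c *: u).
  by rewrite /C /= opprB addrCA; exact: Vadd.
have o := dot_sub_proj p u0; rewrite -/c in o.
have e : `|p| ^+ 2 = `|p - c *: u| ^+ 2 + `|c *: u| ^+ 2.
  move: o; rewrite -{2}(subrK (c *: u) p); move: (p - _) => w o.
  have o' : '[w, c *: u] = 0 by rewrite dotZr o mulr0.
  have o'' : '[c *: u, w] = 0 by rewrite dotC o' conjC0.
  by rewrite -!dotuu dotDl !dotDr o' o'' addr0 add0r.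
have : `|p| ^+ 2 <= `|p - c *: u| ^+ 2.
  by rewrite ler_pXn2r ?nnegrE //; exact: pmin.
rewrite e gerDl => cu_le0.
have : c *: u == 0 by rewrite -normr_eq0 -sqrf_eq0 eq_le cu_le0 exprn_ge0.
rewrite scaler_eq0 (negPf u0) orbF mulf_eq0 invr_eq0 dotuu sqrf_eq0 normr_eq0.
by rewrite (negPf u0) orbF => /eqP.
Qed.

End Hilbert.
(** * Finitely supported means *)

(** A mean is a probability measure with finite support and dyadic weights,
    given by a binary tree: a node is the average of its two subtrees.
    Properties of integrals then follow by structural induction. *)
Inductive mean (K : Type) := point_mass of K | midpoint of mean K & mean K.

Fixpoint integral {F : fieldType} {E : lmodType F} {K : Type} (mu : mean K)
    (f : K -> E) : E :=
  match mu with
  | point_mass a => f a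
  | midpoint mu nu => 2^-1 *: (integral mu f + integral nu f)
  end.

Fixpoint map_mean {K L : Type} (h : K -> L) (mu : mean K) : mean L :=
  match mu with
  | point_mass a => point_mass (h a)
  | midpoint mu nu => midpoint (map_mean h mu) (map_mean h nu)
  end.

Section MeanAlgebra.
Context {F : fieldType} {E : lmodType F} {K : Type}.
Implicit Types (mu nu : mean K) (f g : K -> E).

Lemma eq_integral mu f g : f =1 g -> integral mu f = integral mu g.
Proof. by move=> fg; congr integral; apply/funext. Qed.

Lemma integral_map {L : Type} (h : L -> K) (mu : mean L) f :
  integral (map_mean h mu) f = integral mu (f \o h).
Proof. by elim: mu => //= mu -> nu ->. Qed.

Lemma integralD mu f g :
  integral mu (fun a => f a + g a) = integral mu f + integral mu g.
Proof. by elim: mu => //= mu -> nu ->; rewrite -scalerDr addrACA. Qed.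

Lemma integral_semilinear {E' : lmodType F} (L : E -> E') mu f :
  {morph L : u v / u + v} -> (forall u, L (2^-1 *: u) = 2^-1 *: L u) ->
  L (integral mu f) = integral mu (L \o f).
Proof.
by move=> LD LZ; elim: mu => //= mu IHmu nu IHnu; rewrite LZ LD IHmu IHnu.
Qed.

End MeanAlgebra.

Lemma integral_fubini {F : fieldType} {E : lmodType F} {K L : Type}
    (mu : mean K) (nu : mean L) (f : K -> L -> E) :
  integral mu (fun a => integral nu (f a)) =
  integral nu (fun b => integral mu (f^~ b)).
Proof.
elim: mu => //= mu -> mu' ->; rewrite -integralD.
by rewrite (integral_semilinear (L := fun u => 2^-1 *: u)) //; exact: scalerDr.
Qed.


Lemma ler_norm_integral {F : numFieldType} {E : normedModType F} {K : Type}
    (mu : mean K) (f : K -> E) (c : F) :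
  (forall a, `|f a| <= c) -> `|integral mu f| <= c.
Proof.
move=> fc; elim: mu => //= mu IHmu nu IHnu.
rewrite normrZ normfV normr_nat mulrC ler_pdivrMr // mulr_natr mulr2n.
by rewrite (le_trans (ler_normD _ _)) // lerD.
Qed.

Lemma ler_integral {F : numFieldType} {K : Type} (mu : mean K) (f g : K -> F^o) :
  (forall a, f a <= g a) -> integral mu f <= integral mu g.
Proof.
move=> fg; elim: mu => //= mu IHmu nu IHnu.
by rewrite ler_wpM2l ?invr_ge0 // lerD.
Qed.

Lemma integral_cst {F : numFieldType} {E : lmodType F} {K : Type} (mu : mean K)
    (c : E) : integral mu (fun=> c) = c.
Proof.
elim: mu => //= mu -> nu ->.
by rewrite scalerDr -scalerDl -{1 2}[2^-1]mul1r -splitr scale1r.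
Qed.

Definition convolution {K : zmodType} (mu nu : mean K) : mean K :=
  (fix conv mu := match mu with
   | point_mass a => map_mean (+%R a) nu
   | midpoint mu mu' => midpoint (conv mu) (conv mu')
   end) mu.

Lemma integral_convolution {F : fieldType} {E : lmodType F} {K : zmodType}
    (mu nu : mean K) (f : K -> E) :
  integral (convolution mu nu) f =
  integral mu (fun a => integral nu (fun b => f (a + b))).
Proof. by elim: mu => [a|mu /= -> mu' ->] //=; rewrite integral_map. Qed.

Lemma integral_convolutionC {F : fieldType} {E : lmodType F} {K : zmodType}
    (mu nu : mean K) (f : K -> E) :
  integral (convolution mu nu) f = integral (convolution nu mu) f.
Proof.
rewrite !integral_convolution integral_fubini; apply: eq_integral => b.
by apply: eq_integral => a; rewrite addrC.
Qed.

Lemma integral_convolutionA {F : fieldType} {E : lmodType F} {K : zmodType}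
    (mu nu rho : mean K) (f : K -> E) :
  integral (convolution (convolution mu nu) rho) f =
  integral (convolution mu (convolution nu rho)) f.
Proof.
rewrite !integral_convolution; apply: eq_integral => a.
rewrite integral_convolution; apply: eq_integral => b.
by apply: eq_integral => c; rewrite addrA.
Qed.
(** * Trigonometric polynomials concentrated at the origin *)
Section Trigonometric.
Context {R : realType} {K : topologicalZmodType}.
Variable Xi : set (K -> R[i]^o).
Hypothesis XiP : forall chi, Xi chi -> characters chi.
Hypothesis Xi1 : Xi (fun=> 1).
Hypothesis XiM : forall chi psi, Xi chi -> Xi psi -> Xi (fun a => chi a * psi a).
Hypothesis XiN : forall chi, Xi chi -> Xi (fun a => chi (- a)).

Inductive trigonometric : (K -> R[i]^o) -> Prop :=
| trig_character chi : Xi chi -> trigonometric chi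
| trigD g h : trigonometric g -> trigonometric h ->
    trigonometric (fun a => g a + h a)
| trigZ c g : trigonometric g -> trigonometric (fun a => c * g a).

Lemma trigM g h : trigonometric g -> trigonometric h ->
  trigonometric (fun a => g a * h a).
Proof.
move=> tg; elim: tg h => {g} [chi Xchi h th|g g' _ IHg _ IHg' h th|c g _ IHg h th].
- elim: th => {h} [psi Xpsi|h h' _ IHh _ IHh'|c h _ IHh].
  + exact/trig_character/XiM.
  + under eq_fun do rewrite mulrDr; exact: trigD.
  + under eq_fun do rewrite mulrCA; exact: trigZ.
- by under eq_fun do rewrite mulrDl; apply: trigD; [exact: IHg|exact: IHg'].
- by under eq_fun do rewrite -mulrA; apply: trigZ; exact: IHg.
Qed.

Lemma trigX g n : trigonometric g -> trigonometric (fun a => g a ^+ n).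
Proof.
move=> tg; elim: n => [|n IH]; first exact: trig_character.
by under eq_fun do rewrite exprS; exact: trigM.
Qed.

Lemma character0 (chi : K -> R[i]^o) : characters chi -> chi 0 = 1.
Proof.
move=> [_ n1 D]; have c0 : chi 0 != 0 by rewrite -normr_eq0 n1 oner_neq0.
by apply: (mulfI c0); rewrite mulr1 -D addr0.
Qed.

Lemma characterN (chi : K -> R[i]^o) a : characters chi ->
  chi (- a) = Num.conj (chi a).
Proof.
move=> cP; have [_ n1 D] := cP.
have c0 : chi a != 0 by rewrite -normr_eq0 n1 oner_neq0.
apply: (mulfI c0); rewrite -D subrr character0 //.
by rewrite -normCK n1 expr1n.
Qed.

Lemma Re_continuous : continuous (fun z : R[i]^o => complex.Re z : R^o).
Proof.
move=> z; apply/(@cvgrPdist_lt _ _ _ (nbhs (z : R[i]^o)) _ _ _) => e e0.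
have e0' : 0 < e%:C by rewrite ltcR.
apply: filterS (nbhsx_ballx (z : R[i]^o) _ e0') => w.
rewrite -ball_normE /= => zw.
rewrite -ltcR; apply: le_lt_trans zw; rewrite -raddfB.
exact: normc_ge_Re.
Qed.

(** The basic trigonometric polynomial with values in [0, 1] and value 1 at
    0; it is less than 1 wherever chi differs from 1. *)
Definition half_one_plus_Re (chi : K -> R[i]^o) (a : K) : R :=
  (1 + complex.Re (chi a)) / 2.

Definition bump (p : K -> R) := [/\ trigonometric (fun a => (p a)%:C),
  continuous (p : K -> R^o), p 0 = 1 & forall a, 0 <= p a <= 1].

Lemma bump_half_one_plus_Re chi : Xi chi -> bump (half_one_plus_Re chi).
Proof.
move=> Xchi; have cP := XiP Xchi; have [cc n1 _] := cP; split.
- have -> : (fun a => (half_one_plus_Re chi a)%:C) =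
      (fun a => 2^-1 * (1 + 2^-1 * (chi a + chi (- a)))) :> (K -> R[i]^o).
    apply/funext => a; rewrite characterN // /half_one_plus_Re mulrC.
    rewrite rmorphM rmorphD /= fmorphV !rmorph1 rmorph_nat.
    by rewrite ReJ_add [X in 1 + X]mulrC.
  apply/trigZ/trigD; first exact: trig_character.
  by apply/trigZ/trigD; [exact: trig_character|exact/trig_character/XiN].
- move=> a; apply: cvgMl => //; apply: cvgD; first exact: cvg_cst.
  apply: (@continuous_comp _ _ _ chi (fun z : R[i]^o => complex.Re z : R^o)) => //.
    exact: cc.
  exact: Re_continuous.
- by rewrite /half_one_plus_Re character0 // -[1 + _]/(2) divff.
- move=> a; have : `|complex.Re (chi a)| <= 1.
    by rewrite -lecR rmorph1 -(n1 a) normc_ge_Re.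
  by rewrite /half_one_plus_Re ler_norml => /andP[? ?]; lra.
Qed.

Lemma half_one_plus_Re_lt1 chi a : Xi chi -> chi a != 1 ->
  half_one_plus_Re chi a < 1.
Proof.
move=> Xchi c1; have [_ _ _ b] := bump_half_one_plus_Re Xchi.
rewrite lt_neqAle; have /andP[_ ->] := b a; rewrite andbT.
apply: contra c1 => /eqP e1; have [_ n1 _] := XiP Xchi.
have re1 : complex.Re (chi a) = 1 by move: e1; rewrite /half_one_plus_Re; lra.
have im0 : complex.Im (chi a) = 0.
  have := add_Re2_Im2 (chi a); rewrite n1 re1 !expr1n => -[/eqP].
  by rewrite -subr_eq0 addrC addKr sqrf_eq0 => /eqP.
by rewrite eq_complex re1 im0 !eqxx.
Qed.

Lemma bump1 : bump (fun=> 1).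
Proof.
split=> // [|a|a]; [exact: trig_character|exact: cvg_cst|by rewrite ler01 lexx].
Qed.

Lemma bumpM p q : bump p -> bump q -> bump (fun a => p a * q a).
Proof.
move=> [tp cp p0 p1] [tq cq q0 q1]; split.
- by under eq_fun do rewrite rmorphM; exact: trigM.
- by move=> a; apply: cvgM; [exact: cp|exact: cq].
- by rewrite p0 q0 mulr1.
- move=> a; have /andP[pa pa1] := p1 a; have /andP[qa qa1] := q1 a.
  by rewrite mulr_ge0 // mulr_ile1.
Qed.

(** Each point other than 0 has a neighbourhood on which some function
    (1 + Re chi) / 2 is bounded away from 1; the product of finitely many of
    them is bounded away from 1 off U. *)
Lemma bump_concentrated (U : set K) : compact [set: K] ->
  (forall a, a != 0 -> exists2 chi, Xi chi & chi a != 1) ->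
  nbhs 0 U ->
  exists (p : K -> R) (eta : R),
    [/\ bump p, 0 < eta < 1 & forall a, ~ U a -> p a <= 1 - eta].
Proof.
move=> cK sep U0.
pose P (B : set K) := exists (p : K -> R) (eta : R),
  [/\ bump p, 0 < eta < 1 & forall a, B a -> p a <= 1 - eta].
suff [p [eta [bp eta01 Bp]]] : P (~` U^°).
  exists p, eta; split=> // a nUa; apply: Bp => /interior_subset; exact: nUa.
apply: compact_subadditive.
- apply: subclosed_compact cK _ => //; exact/open_closedC/open_interior.
- by exists (fun=> 1), 2^-1; split=> //; [exact: bump1|lra].
- move=> B C [p [s [bp s01 Bp]]] [q [t [bq t01 Cq]]].
  exists (fun a => p a * q a), (Num.min s t); split; first exact: bumpM.
    move/andP: s01 => [s0 s1]; move/andP: t01 => [t0 t1].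
    by rewrite lt_min s0 t0 gt_min s1.
  have [_ _ _ p1] := bp; have [_ _ _ q1] := bq.
  move=> a; have /andP[pa pa1] := p1 a; have /andP[qa qa1] := q1 a.
  have [ms mt] : Num.min s t <= s /\ Num.min s t <= t by rewrite !ge_min !lexx orbT.
  case=> [/Bp|/Cq] h.
    by apply: le_trans (ler_piMr pa qa1) _; lra.
  by apply: le_trans (ler_piMl qa pa1) _; lra.
- by move=> B C BC [p [eta [bp e01 Cp]]]; exists p, eta; split=> // a /BC/Cp.
- move=> a nUa; have a0 : a != 0.
    by apply/eqP => a0; apply: nUa; rewrite a0.
  have [chi Xchi chia] := sep a a0.
  pose p := half_one_plus_Re chi; pose eta := (1 - p a) / 2.
  have bp : bump p by exact: bump_half_one_plus_Re.
  have [_ cp _ p1] := bp.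
  have pa1 : p a < 1 by exact: half_one_plus_Re_lt1.
  have /andP[pa0 _] := p1 a.
  exists [set b | p b < 1 - eta].
    have := cp a; move=> /cvgr_lt; apply; rewrite /eta; lra.
  exists p, eta; split=> // [|b /ltW //].
  by apply/andP; split; rewrite /eta; lra.
Qed.

End Trigonometric.
(** * Common eigenvectors of a compact abelian group *)
Section Eigenvector.
Context {R : realType} {H : completeNormedModType R[i]}.
Variable dot : {dot H for Num.conj}.
Hypothesis hilbertH : hilbert_norm dot.
Context {K : topologicalZmodType}.
Variable T : K -> H -> H.
Hypothesis Tlin : forall a, linear (T a).
Hypothesis Tdot : forall a u w, dot (T a u) (T a w) = dot u w.
Hypothesis T0 : forall u, T 0 u = u.
Hypothesis TD : forall a b u, T (a + b) u = T a (T b u).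

Let T_additive a : {morph T a : u w / u + w}.
Proof. exact: linear_morphD. Qed.

Let T_scale a c u : T a (c *: u) = c *: T a u.
Proof. exact: linear_morphZ. Qed.

Let T_sub a u w : T a (u - w) = T a u - T a w.
Proof. exact: linear_morphB. Qed.

Let T_norm a u : `|T a u| = `|u|.
Proof. by apply: (isometry_norm hilbertH) => *; exact: Tdot. Qed.

Section Twisted.
Variables (chi : K -> R[i]^o) (v : H).
Hypothesis chiP : characters chi.

Definition twisted_orbit (a : K) : H := chi (- a) *: T a v.

Let norm_chi a : `|chi a| = 1. Proof. by case: chiP. Qed.

Let chiNK a : chi a * chi (- a) = 1.
Proof. by case: (chiP) => _ _ <-; rewrite subrr character0. Qed.

Lemma twisted_integral_shift b (mu : mean K) :
  chi (- b) *: T b (integral mu twisted_orbit) =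
  integral (map_mean (+%R b) mu) twisted_orbit.
Proof.
rewrite (integral_semilinear (L := fun u => chi (- b) *: T b u)).
- rewrite integral_map; apply: eq_integral => a /=.
  rewrite /twisted_orbit T_scale TD opprD; have [_ _ ->] := chiP.
  by rewrite scalerA.
- by move=> u w; rewrite T_additive scalerDr.
- by move=> u; rewrite T_scale !scalerA mulrC.
Qed.

(** The component of v for the character chi vanishes: it would be the Haar
    integral of the twisted orbit. *)
Definition mean_null := forall delta : R[i], 0 < delta ->
  exists mu : mean K, `|integral mu twisted_orbit| < delta.

(** The closure S of the averages of the twisted orbit is stable under the
    isometries chi(-b) T b, so these fix its vector of least norm, which is
    not 0 because v is not null. *)
Lemma eigenvector_of_nonnull (V : set H) :
  submod_closed [in V] -> closed V -> (forall a u, V u -> V (T a u)) ->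
  V v -> ~ mean_null ->
  exists2 w, V w /\ w != 0 & forall a, T a w = chi a *: w.
Proof.
move=> [V0 Vlin] cV VT Vv nnull.
have Vadd a u w : V u -> V w -> V (a *: u + w).
  by move=> Vu Vw; have := Vlin a u w; rewrite !inE; apply.
have {}V0 : V 0 by move: V0; rewrite inE.
have Vscale a u : V u -> V (a *: u) by move=> Vu; rewrite -[_ *: _]addr0; exact: Vadd.
pose S := range (fun mu => integral mu twisted_orbit).
have SV : S `<=` V.
  move=> _ [mu _ <-]; elim: mu => [a|mu Vmu nu Vnu] /=.
    by apply: (Vscale); exact: VT.
  by apply: (Vscale); rewrite -[integral mu _]scale1r; exact: Vadd.
have closureP u : closure S u <-> forall e : R[i], 0 < e -> exists mu : mean K,
    `|u - integral mu twisted_orbit| < e.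
  split=> [Su e e0|Su N /nbhs_ballP[e /= e0 eN]].
    have [_ [[mu _ <-]]] := Su _ (nbhsx_ballx u e e0).
    by rewrite -ball_normE; exists mu.
  have [mu mue] := Su e e0; exists (integral mu twisted_orbit); split.
    by exists mu.
  by apply: eN; rewrite -ball_normE.
have Smid u w : closure S u -> closure S w -> closure S (2^-1 *: (u + w)).
  move=> /closureP Su /closureP Sw; apply/closureP => e e0.
  have [mu umu] := Su e e0; have [nu wnu] := Sw e e0.
  exists (midpoint mu nu) => /=; rewrite -scalerBr opprD addrACA.
  rewrite normrZ normfV normr_nat mulrC ltr_pdivrMr // mulr_natr mulr2n.
  by rewrite (le_lt_trans (ler_normD _ _)) // ltrD.
have S0 : closure S !=set0.
  by exists (twisted_orbit 0); apply: subset_closure; exists (point_mass 0).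
have [p Sp pmin] := min_norm hilbertH S0 (@closed_closure _ S) Smid.
have p0 : p != 0.
  apply/eqP => p0; apply: nnull => delta /(proj1 (closureP p) Sp)[mu].
  by rewrite p0 sub0r normrN; exists mu.
exists p.
  split=> //; have := closure_subset SV.
  by rewrite -(closure_id V).1 //; apply.
move=> b; pose q := chi (- b) *: T b p.
have norm_L u : `|chi (- b) *: T b u| = `|u| by rewrite normrZ norm_chi mul1r T_norm.
have Sq : closure S q.
  apply/closureP => e /(proj1 (closureP p) Sp)[mu pmu].
  exists (map_mean (+%R b) mu); rewrite -twisted_integral_shift /q -scalerBr.
  by rewrite -T_sub norm_L.
have pq : p = q.
  apply: (min_norm_unique hilbertH); first by rewrite norm_L.
  by apply: pmin; exact: Smid.
by rewrite {2}pq /q scalerA chiNK scale1r.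
Qed.

End Twisted.

Section Separating.
Variable Xi : set (K -> R[i]^o).
Hypothesis XiP : forall chi, Xi chi -> characters chi.
Hypothesis Xi1 : Xi (fun=> 1).
Hypothesis XiM : forall chi psi, Xi chi -> Xi psi -> Xi (fun a => chi a * psi a).
Hypothesis XiN : forall chi, Xi chi -> Xi (fun a => chi (- a)).
Hypothesis Xi_separates : forall a, a != 0 -> exists2 chi, Xi chi & chi a != 1.
Hypothesis cK : compact [set: K].
Variable v : H.
Hypothesis v0 : v != 0.
Hypothesis Tv_continuous : continuous (fun a => T a v).

Let phi (a : K) : R[i]^o := dot (T a v) v.

(** The mean mu is required to work after convolution with any nu, for then
    the convolution of means that work for g and for h works for g + h.  For a
    single character, convolving amounts to applying further contractions to
    an average of small norm. *)
Lemma trig_null g : (forall chi, Xi chi -> mean_null chi v) ->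
  trigonometric Xi g -> forall delta : R[i], 0 < delta ->
  exists mu : mean K, forall nu : mean K,
    `|integral (convolution mu nu) (fun a => g a * phi a : R[i]^o)| <= delta.
Proof.
move=> null; elim=> {g} [chi Xchi|g h _ IHg _ IHh|c g _ IHg] delta delta0.
- have v_gt0 : 0 < `|v| by rewrite normr_gt0.
  have [mu mu_lt] := null _ (XiN Xchi) _ (divr_gt0 delta0 v_gt0).
  exists mu => nu; rewrite integral_convolutionC integral_convolution.
  apply: ler_norm_integral => b.
  pose f a := chi a *: T a v.
  have fE : twisted_orbit (fun a => chi (- a)) v = f.
    by apply/funext => a; rewrite /twisted_orbit opprK.
  have -> : integral mu (fun a => chi (b + a) * phi (b + a) : R[i]^o) =
      dot (chi b *: T b (integral mu f)) v.
    rewrite (integral_semilinear (L := fun u => dot (chi b *: T b u) v : R[i]^o)).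
    + apply: eq_integral => a /=; rewrite /f T_scale scalerA -TD dotZl /phi.
      by case: (XiP Xchi) => _ _ ->.
    + by move=> u w; rewrite T_additive scalerDr dotDl.
    + by move=> u; rewrite T_scale !dotZl mulrCA.
  apply: le_trans (cauchy_schwarz hilbertH _ _) _.
  have [_ n1 _] := XiP Xchi; rewrite normrZ n1 mul1r T_norm.
  by rewrite -ler_pdivlMr // -fE ltW.
- have d2 : 0 < delta / 2 by rewrite divr_gt0.
  have [mu muP] := IHg _ d2; have [nu nuP] := IHh _ d2.
  exists (convolution mu nu) => rho.
  under eq_fun do rewrite mulrDl.
  rewrite integralD (le_trans (ler_normD _ _)) // [leRHS]splitr lerD //.
    by rewrite integral_convolutionA.
  have -> : integral (convolution (convolution mu nu) rho)
      (fun a => h a * phi a : R[i]^o) =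
    integral (convolution nu (convolution mu rho)) (fun a => h a * phi a : R[i]^o).
    rewrite -integral_convolutionA !(integral_convolution _ rho).
    by rewrite integral_convolutionC.
  exact: nuP.
- have c1 : 0 < `|c| + 1 by rewrite ltr_wpDl.
  have [mu muP] := IHg _ (divr_gt0 delta0 c1); exists mu => nu.
  under eq_fun do rewrite -mulrA.
  rewrite -(integral_semilinear (L := fun z : R[i]^o => c * z : R[i]^o)).
  + rewrite normrM; apply: (@le_trans _ _ ((`|c| + 1) * (delta / (`|c| + 1)))).
      by apply: ler_pM => //; rewrite lerDl.
    by rewrite mulrC divfK // gt_eqF.
  + by move=> x y; rewrite mulrDr.
  + by move=> x; rewrite scalerAr.
Qed.

(** A substitute for the positivity of the Haar measure of U: by compactness
    finitely many translates of U cover K, so the mean sigma of the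
    corresponding points gives some translate of U a weight at least c. *)
Lemma covering_mean (U : set K) : nbhs 0 U ->
  exists (sigma : mean K) (c : R), 0 < c /\ forall a (g : K -> R^o) (s : R), 0 <= s ->
    (forall b, 0 <= g b) -> (forall u, U u -> s <= g u) ->
    c * s <= integral sigma (fun b => g (a + b)).
Proof.
move=> U0.
pose P (B : set K) := exists (sigma : mean K) (c : R), 0 < c /\
  forall a, B a -> forall (g : K -> R^o) (s : R), 0 <= s ->
    (forall b, 0 <= g b) -> (forall u, U u -> s <= g u) ->
    c * s <= integral sigma (fun b => g (a + b)).
suff [sigma [c [c0 H1]]] : P [set: K].
  by exists sigma, c; split=> // a; exact: H1.
apply: compact_subadditive => //.
- by exists (point_mass 0), 1; split.
- move=> B C [s1 [c1 [c10 H1]]] [s2 [c2 [c20 H2]]].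
  exists (midpoint s1 s2), (Num.min c1 c2 / 2); split.
    by rewrite divr_gt0 // lt_min c10.
  move=> a BCa g s s0 g0 gU /=.
  have i0 (sg : mean K) : 0 <= integral sg (fun b => g (a + b)).
    by rewrite -(integral_cst (E := R^o) sg 0); exact: ler_integral.
  have [m1 m2] : Num.min c1 c2 <= c1 /\ Num.min c1 c2 <= c2.
    by rewrite !ge_min !lexx orbT.
  rewrite mulrAC -[leRHS]/(2^-1 * _) [leRHS]mulrC ler_pM2r ?invr_gt0 //.
  case: BCa => [/H1|/H2] /(_ g s s0 g0 gU) h.
    by rewrite -[leLHS]addr0 lerD // (le_trans _ h) // ler_wpM2r.
  by rewrite -[leLHS]add0r lerD // (le_trans _ h) // ler_wpM2r.
- by move=> B C BC [sg [c [c0 h]]]; exists sg, c; split=> // a /BC; exact: h.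
- move=> a _; exists [set b | U (b - a)].
    have oU : open [set b | U^° (b - a)] by apply: open_shift; exact: open_interior.
    apply: filterS (open_nbhs_nbhs (conj oU _)); last by rewrite /= subrr.
    by move=> b /interior_subset.
  exists (point_mass (- a)), 1; split=> // b Ub g s s0 g0 gU /=.
  by rewrite mul1r; exact: gU.
Qed.

(** Suppose that all characters in Xi are null.  The function phi has real
    part at least |v|^2/2 on some U, and there is a bump p with p <= 1 - eta
    off U.  For g = p ^+ n, the average of g Re phi over a suitable mean
    is at least a positive multiple of c (1 - eta/2)^n - 3 (1 - eta)^n, with c independent
    of n, by [covering_mean] for the set where p > 1 - eta/2.  This is
    positive for n large, against [trig_null]. *)
Lemma exists_nonnull_character : exists2 chi, Xi chi & ~ mean_null chi v.
Proof.
apply: contrapT => none.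
have null chi : Xi chi -> mean_null chi v.
  by move=> Xchi; apply: contrapT => nn; apply: none; exists chi.
pose r : R := complex.Re (`|v| ^+ 2).
have rE : `|v| ^+ 2 = r%:C by rewrite RRe_real // ger0_real // exprn_ge0.
have r0 : 0 < r by rewrite -ltcR -rE exprn_gt0 // normr_gt0.
pose rphi a : R := complex.Re (phi a).
have rphi_ge a : - r <= rphi a.
  have : `|phi a| <= r%:C.
    by rewrite -rE expr2 (le_trans (cauchy_schwarz hilbertH _ _)) // T_norm.
  move=> /(le_trans (normc_ge_Re _)); rewrite lecR ler_norml.
  by case/andP.
pose U := [set a | r / 2 < rphi a].
have U0 : nbhs 0 U.
  have phic : continuous phi.
    move=> a.
    apply: (@continuous_comp _ _ _ (fun a => T a v) (fun u => dot u v : R[i]^o)).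
      exact: Tv_continuous.
    exact: dot_continuousl.
  have rphic : continuous (rphi : K -> R^o).
    move=> a; apply: (@continuous_comp _ _ _ phi (fun z : R[i]^o => complex.Re z : R^o)).
      exact: phic.
    exact: Re_continuous.
  have rphi0 : rphi 0 = r by rewrite /rphi /phi T0 (dotuu hilbertH).
  have := rphic 0; move=> /cvgr_gt; apply; rewrite rphi0; lra.
have [p [eta [bp /andP[eta0 eta1] pU]]] :=
  bump_concentrated XiP Xi1 XiM XiN cK Xi_separates U0.
have [tp cp p0 p01] := bp.
have V0 : nbhs 0 [set a | 1 - eta / 2 < p a].
  by have := cp 0; move=> /cvgr_gt; apply; rewrite p0; lra.
have [sigma [c [c0 sigmaP]]] := covering_mean V0.
(* the ratio of the two powers tends to 0 geometrically *)
have [n n_lt] : exists n : nat, 3 * (1 - eta) ^+ n < c * (1 - eta / 2) ^+ n.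
  pose x : R := (1 - eta) / (1 - eta / 2).
  have d0 : 0 < 1 - eta / 2 by lra.
  have x0 : 0 <= x by rewrite divr_ge0 //; lra.
  have x1 : `|x| < 1 by rewrite ger0_norm // ltr_pdivrMr //; lra.
  have [n _ /(_ n (leqnn n)) xn] : \forall n \near \oo, x ^+ n < c / 3.
    by apply: (cvgr_lt _ (cvg_expr x1)); rewrite divr_gt0.
  exists n; have -> : (1 - eta) ^+ n = x ^+ n * (1 - eta / 2) ^+ n.
    by rewrite -exprMn divfK // gt_eqF.
  rewrite mulrA ltr_pM2r ?exprn_gt0 //.
  by move: xn => /=; lra.
pose s := (1 - eta / 2) ^+ n; pose t := (1 - eta) ^+ n.
have s0 : 0 <= s by rewrite exprn_ge0 //; lra.
have t0 : 0 <= t by rewrite exprn_ge0 //; lra.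
pose g (a : K) : R^o := p a ^+ n.
have g0 a : 0 <= g a by have /andP[pa _] := p01 a; exact: exprn_ge0.
have tg : trigonometric Xi (fun a => (g a)%:C).
  by under eq_fun do rewrite rmorphXn; exact: trigX.
pose delta := r * (c * s - 3 * t) / 4.
have delta0 : 0 < delta.
  by rewrite divr_gt0 // mulr_gt0 // subr_gt0.
have [|mu /(_ sigma)] := trig_null null tg (_ : 0 < delta%:C).
  by rewrite ltcR.
set I := integral _ _ => I_le.
have ReI : complex.Re I = integral (convolution mu sigma) (fun a => g a * rphi a : R^o).
  rewrite /I; elim: (convolution mu sigma) => [a|m1 IH1 m2 IH2] /=.
    by rewrite /rphi; case: (phi a) => x y /=; rewrite mul0r subr0.
  rewrite -IH1 -IH2 -raddfD /=.
  have -> : (2^-1 : R[i]) = (2^-1)%:C by rewrite fmorphV rmorph_nat.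
  by case: (_ + _) => x y /=; rewrite mul0r subr0.
have : 2 * delta <= complex.Re I.
  rewrite ReI integral_convolution.
  have -> : 2 * delta = integral mu (fun=> 2 * delta : R^o) by rewrite integral_cst.
  apply: ler_integral => a.
  (* on U, rphi >= r / 2; off U, g <= t and rphi >= - r *)
  apply: (@le_trans _ _
      (integral sigma (fun b => r / 2 * g (a + b) - 3 / 2 * r * t : R^o))).
    rewrite integralD integral_cst.
    rewrite -(integral_semilinear (L := fun z : R^o => r / 2 * z : R^o)).
    - have := sigmaP a g s s0 g0.
      suff h : forall u, [set u | 1 - eta / 2 < p u] u -> s <= g u.
        by move=> /(_ h) cs; rewrite /delta; have := ler_wpM2l (ltW r0) cs; lra.
      by move=> u /= /ltW pu; apply: lerXn2r; rewrite ?nnegrE //; lra.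
    - by move=> x y; rewrite mulrDr.
    - by move=> x; rewrite scalerAr.
  apply: ler_integral => b; have gb := g0 (a + b).
  case: (pselect (U (a + b))) => [/ltW Uab|/pU pab].
    by have := ler_wpM2l gb Uab; have := mulr_ge0 (ltW r0) t0; lra.
  have gt : g (a + b) <= t.
    by have /andP[pa _] := p01 (a + b); apply: lerXn2r; rewrite ?nnegrE //; lra.
  by have := ler_wpM2l gb (rphi_ge (a + b)); have := ler_wpM2l (ltW r0) gt; lra.
have : complex.Re I <= delta.
  rewrite -lecR; apply: le_trans I_le; apply: le_trans (normc_ge_Re _).
  by rewrite lecR ler_norm.
by lra.
Qed.

(** The part of the Peter-Weyl theorem that is used: characters of a family
    that separates points and is closed under product and inverse suffice. *)
Lemma exists_eigenvector (V : set H) :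
  submod_closed [in V] -> closed V -> (forall a u, V u -> V (T a u)) -> V v ->
  exists2 chi, Xi chi &
    exists2 w, V w /\ w != 0 & forall a, T a w = chi a *: w.
Proof.
move=> Vsub cV VT Vv; have [chi Xchi nn] := exists_nonnull_character.
exists chi => //; apply: eigenvector_of_nonnull nn => //; exact: XiP.
Qed.

End Separating.
End Eigenvector.
(** * Subgroups as topological groups *)
Lemma borel_preimage (X Y : topologicalType) (f : X -> Y) (B : set Y) :
  continuous f -> <<s (@open Y) >> B -> <<s (@open X) >> (f @^-1` B).
Proof.
move=> /continuousP cf.
suff : <<s (@open Y) >> `<=` [set B | <<s (@open X) >> (f @^-1` B)] by apply.
apply: smallest_sub => [|O /cf oO]; last exact: sub_sigma_algebra.
have [s0 sC sU] := @smallest_sigma_algebra X setT (@open X).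
by split=> [|A /sC|A /sU] //=; rewrite ?setTD // preimage_bigcup.
Qed.

(** The proof that L is a subgroup is an argument of the type, so that group
    and topology instances can be attached to it. *)
Definition subgroup_type (G : zmodType) (L : set G) (_ : zmod_closed [in L]) :
  Type := set_type L.

Section SubgroupAlgebra.
Context {G : zmodType} {L : set G} (sL : zmod_closed [in L]).
Local Notation K := (subgroup_type sL).

HB.instance Definition _ := Choice.copy K (set_type L).

Definition subgroup_val (a : K) : G := \val a.
Lemma subgroup_valP a : L (subgroup_val a). Proof. exact: set_valP. Qed.
Definition subgroup_mk (x : G) (Lx : L x) : K := SigSub (mem_set Lx).

Lemma subgroup_val_inj : injective subgroup_val. Proof. exact: val_inj. Qed.

Let L0 : L 0. Proof. by case: sL => /set_mem. Qed.
Let LB x y : L x -> L y -> L (x - y).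
Proof. by case: sL => _ LB /mem_set Lx /mem_set Ly; exact/set_mem/LB. Qed.
Let LN x : L x -> L (- x). Proof. by move=> Lx; rewrite -sub0r; exact: LB. Qed.
Let LD x y : L x -> L y -> L (x + y).
Proof. by move=> Lx Ly; rewrite -[y]opprK; exact/LB/LN. Qed.

Let zero : K := subgroup_mk L0.
Let opp (a : K) : K := subgroup_mk (LN (subgroup_valP a)).
Let add (a b : K) : K := subgroup_mk (LD (subgroup_valP a) (subgroup_valP b)).

Let addA : associative add.
Proof. by move=> a b c; apply: subgroup_val_inj; exact: addrA. Qed.
Let addC : commutative add.
Proof. by move=> a b; apply: subgroup_val_inj; exact: addrC. Qed.
Let add0 : left_id zero add.
Proof. by move=> a; apply: subgroup_val_inj; exact: add0r. Qed.
Let addN : left_inverse zero opp add.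
Proof. by move=> a; apply: subgroup_val_inj; exact: addNr. Qed.

HB.instance Definition _ := GRing.isZmodule.Build K addA addC add0 addN.

End SubgroupAlgebra.

Section SubgroupTopology.
Context {G : topologicalZmodType} {L : set G} (sL : zmod_closed [in L]).
Local Notation K := (subgroup_type sL).
Local Notation val := (subgroup_val (sL := sL)).

HB.instance Definition _ := Topological.copy K (set_type L).

Lemma subgroup_val_continuous : continuous (val : K -> G).
Proof. exact: initial_continuous. Qed.

Lemma subgroup_nbhs (a : K) (N : set K) : nbhs a N ->
  exists2 O : set G, open_nbhs (val a) O & val @^-1` O `<=` N.
Proof.
by rewrite nbhsE => -[_ [[ O oO <-] Oa] ON]; exists O.
Qed.

Lemma subgroup_sub_continuous : continuous (fun x : K * K => x.1 - x.2).
Proof.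
move=> [a b] N /subgroup_nbhs[ O [oO Oab] ON].
have : nbhs (val a, val b) [set p : G * G | O (p.1 - p.2)].
  by apply: (@sub_continuous G (val a, val b)); exact: open_nbhs_nbhs.
move=> [[P Q] /= [aP bQ] PQ].
exists (val @^-1` P, val @^-1` Q) => /=.
  by split; exact: subgroup_val_continuous.
by move=> [c d] [/= Pc Qd]; apply: ON; exact: (PQ (val c, val d)).
Qed.

HB.instance Definition _ :=
  PreTopologicalNmodule_isTopologicalZmodule.Build K subgroup_sub_continuous.

Lemma subgroup_hausdorff : hausdorff_space G -> hausdorff_space K.
Proof.
move=> hG a b ab; apply: subgroup_val_inj; apply: hG => A B aA bB.
have [||c [Ac Bc]] := ab (val @^-1` A) (val @^-1` B).
- exact: subgroup_val_continuous.
- exact: subgroup_val_continuous.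
by exists (val c).
Qed.

Lemma subgroup_compact : compact L -> compact [set: K].
Proof.
move=> cL F FF _.
have FL : (val @ F) L.
  by apply: (@filterS _ F _ setT) => [a _|]; [exact: subgroup_valP|exact: filterT].
have [x [Lx cx]] := cL _ _ FL.
exists (subgroup_mk sL Lx); split=> // A N FA /subgroup_nbhs[ O [oO Ox] ON].
have FvA : (val @ F) [set val a | a in A].
  by apply: (@filterS _ F _ A) => // a Aa; exists a.
have [_ [[a Aa <-] Oa]] := cx _ _ FvA (open_nbhs_nbhs (conj oO Ox)).
by exists a; split=> //; exact: ON.
Qed.

Lemma subgroup_second_countable : @second_countable G -> @second_countable K.
Proof.
move=> [B cB [Bo Bb]]; exists [set val @^-1` O | O in B].
  exact: sub_countable (card_image_le _ _) cB.
split=> [_ [ O /Bo oO <-]|a N /subgroup_nbhs[ O Oa ON]]; first by exists O.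
have [V [BV Va] VO] := Bb _ _ (open_nbhs_nbhs Oa).
exists (val @^-1` V); first by split=> //; exists V.
by move=> b /VO; exact: ON.
Qed.

End SubgroupTopology.
(** * Alternating bicharacters and their representations *)
Lemma submod_closedP (F : pzRingType) (E : lmodType F) (V : set E) :
  submod_closed [in V] <->
  V 0 /\ forall a u w, V u -> V w -> V (a *: u + w).
Proof.
split=> [[V0 Vlin]|[V0 Vlin]].
  split=> [|a u w Vu Vw]; first by move: V0; rewrite inE.
  by have := Vlin a u w; rewrite !inE; apply.
by split=> [|a u w]; rewrite !inE //; exact: Vlin.
Qed.

Section AlternatingBicharacter.
Context {R : realType} {G : topologicalZmodType}.
Variable m : bicharacter R G.
Hypothesis alt_m : Defs.alternating m.

Lemma bichar0l y : m 0 y = 1.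
Proof.
have m0 : m 0 y != 0 by rewrite -normr_eq0 bichar_norm oner_neq0.
by apply: (mulfI m0); rewrite mulr1 -bicharDl addr0.
Qed.

Lemma bichar0r x : m x 0 = 1. Proof. exact: character0 (bichar_character m x). Qed.

Lemma bicharNN x y : m (- x) y = m x (- y).
Proof.
have m0 : m x y != 0 by rewrite -normr_eq0 bichar_norm oner_neq0.
by apply: (mulIf m0); rewrite -bicharDl -bicharDr !addNr bichar0l bichar0r.
Qed.

Lemma bichar_flip x y : m x y = 1 -> m y x = 1.
Proof. by move=> xy; have [/(_ x y)] := alt_m; rewrite xy mul1r. Qed.

Lemma bicharMz x y k : m x y = 1 -> m (x *~ k) y = 1.
Proof.
move=> xy.
have pos n : m (x *~ n%:Z) y = 1.
  by elim: n => [|n IH]; rewrite ?bichar0l // -pmulrn mulrS bicharDl xy mul1r pmulrn.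
case: k => n; first exact: pos.
have m0 : m (x *~ n.+1) y != 0 by rewrite pos oner_neq0.
by rewrite NegzE mulrNz; apply: (mulIf m0); rewrite -bicharDl addNr bichar0l mul1r pos.
Qed.

(** Since m x x = 1, adjoining x to L gives an isotropic subgroup, which is L
    by maximality. *)
Lemma maximal_isotropic_annihilator (L : set G) x :
  maximal_isotropic m L -> (forall a, L a -> m a x = 1) -> L x.
Proof.
move=> [sL iL maxL] Lx.
have [L0 LB] : L 0 /\ forall a b, L a -> L b -> L (a - b).
  case: sL => L0 LB; split=> [|a b La Lb]; first by move: L0; rewrite inE.
  by have := LB a b; rewrite !inE; apply.
pose B := [set z | exists k : int, L (z - x *~ k)].
have xx : m x x = 1 by case: alt_m.
suff -> : L = B by exists 1; rewrite mulr1z subrr.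
apply/esym/maxL.
- split=> [|y z]; first by rewrite inE; exists 0; rewrite mulr0z subrr.
  rewrite !inE => -[k Ly] [l Lz]; exists (k - l).
  have -> : y - z - x *~ (k - l) = (y - x *~ k) - (z - x *~ l).
    by rewrite mulrzBr !opprD !opprK addrACA.
  exact: LB.
- move=> y z [k Ly] [l Lz].
  suff mLx u w : L u -> L w -> m (u + x *~ k) (w + x *~ l) = 1.
    by rewrite -(subrK (x *~ k) y) -(subrK (x *~ l) z); exact: mLx.
  move=> Lu Lw; rewrite !(bicharDl, bicharDr) (iL _ _ Lu Lw).
  rewrite (bichar_flip (bicharMz l (bichar_flip (Lx _ Lu)))).
  rewrite (bicharMz k (bichar_flip (Lx _ Lw))).
  by rewrite (bicharMz k (bichar_flip (bicharMz l xx))) !mulr1.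
- by move=> a La; exists 0; rewrite mulr0z subr0.
Qed.

End AlternatingBicharacter.

Section MRepresentation.
Context {R : realType} {G : topologicalZmodType} {m : bicharacter R G}.
Context {H : completeNormedModType R[i]} {dot : {dot H for Num.conj}}.
Hypothesis hilbertH : hilbert_norm dot.
Hypothesis alt_m : Defs.alternating m.
Variable W : mrepresentation dot m.
Local Notation op x := (unitary_op (W x)).

Lemma op_linear x : linear (op x).
Proof. by have [lin iso _] := set_valP (W x); exact: lin. Qed.

Lemma op_dot x u w : dot (op x u) (op x w) = dot u w.
Proof. by have [lin iso _] := set_valP (W x); exact: iso. Qed.

Lemma opM x y u : op x (op y u) = m x y *: op (x + y) u.
Proof. exact: (congr1 (fun f : H -> H => f u) (mrepM W x y)). Qed.

Lemma op0 u : op 0 u = u. Proof. by rewrite (mrep0 W). Qed.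

Lemma opNK x u : op (- x) (op x u) = u.
Proof.
have [_ mxx] := alt_m; rewrite opM addNr op0.
have -> : m (- x) x = 1; last by rewrite scale1r.
by rewrite -[LHS]mulr1 -(mxx x) -bicharDl addNr bichar0l mxx.
Qed.

(** As m x x = 1, the operator of - x is the inverse, hence the adjoint, of
    that of x; this makes orthogonal complements of invariant sets invariant. *)
Lemma op_adjoint x u w : dot (op x u) w = dot u (op (- x) w).
Proof. by rewrite -(op_dot (- x)) opNK. Qed.

Lemma op_norm x u : `|op x u| = `|u|.
Proof. by apply: (isometry_norm hilbertH) => *; exact: op_dot. Qed.

(** The commutation relation; m(a, 2x) is m a x divided by m x a. *)
Lemma opC a x u : op a (op x u) = m a (x *+ 2) *: op x (op a u).
Proof.
rewrite !opM scalerA [x + a]addrC; congr (_ *: _).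
have [/(_ x a) xa _] := alt_m.
by rewrite mulr2n bicharDr -mulrA [m a x * m x a]mulrC xa mulr1.
Qed.

Lemma op_scale x c u : op x (c *: u) = c *: op x u.
Proof. exact/linear_morphZ/op_linear. Qed.

Lemma op_orbit_borel (v : H) (O : set H) : open O ->
  <<s (@open G) >> ((fun x => op x v) @^-1` O).
Proof.
move=> oO; have bW : borel_map W by exact: mrep_borel.
apply: (bW [set U | O (unitary_op U v)]); apply: sub_sigma_algebra.
have /continuousP : continuous (fun U : set_type (unitary_group dot) => unitary_op U v).
  move=> U; apply: (@continuous_comp _ _ _ (set_val : _ -> {ptws H -> H}) (fun f => f v)).
    exact: initial_continuous.
  exact: proj_continuous.
exact.
Qed.

(** A common eigenvector of L in V for the character m(., y) is moved by the
    operator of - y/2 to a fixed vector. *)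
Lemma exists_fixed_vector (L : set G) (V : set H) (u : H) :
  hausdorff_space G -> @second_countable G -> two_regular G -> symplectic m ->
  compact L -> maximal_isotropic m L ->
  submod_closed [in V] -> closed V -> (forall x v, V v -> V (op x v)) ->
  V u -> u != 0 ->
  exists2 w, V w /\ w != 0 & fixed_vectors W L w.
Proof.
move=> hG sG [half _ halfK] [_ [_ _ [beta_inv [betaK _ _]]]] cL [sL iL _].
move=> Vsub cV WV Vu u0.
pose K := subgroup_type sL.
pose val : K -> G := subgroup_val (sL := sL).
pose T (a : K) := op (val a).
pose Xi : set (K -> R[i]^o) := [set chi | exists y, chi = fun a => m (val a) y].
have TD a b v : T (a + b) v = T a (T b v).
  by rewrite /T opM (iL _ _ (subgroup_valP a) (subgroup_valP b)) scale1r.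
have cTu : continuous (fun a => T a u).
  apply: borel_orbit_continuous => //.
  - exact: subgroup_hausdorff.
  - exact: subgroup_compact.
  - exact: subgroup_second_countable.
  - by move=> a v w; rewrite -(linear_morphB (op_linear _)) op_norm.
  - exact: op0.
  - move=> O oO.
    exact: (borel_preimage (@subgroup_val_continuous _ _ sL) (op_orbit_borel u oO)).
have XiP chi : Xi chi -> characters chi.
  move=> [y ->]; split=> [a|a|a b]; [|exact: bichar_norm|exact: bicharDl].
  apply: (@continuous_comp _ _ _ (fun a => (val a, y)) (fun p => m p.1 p.2)).
    by apply: continuous_pair; [exact: subgroup_val_continuous|exact: cst_continuous].
  exact: bichar_continuous.
have Xi_separates (a : K) : a != 0 -> exists2 chi, Xi chi & chi a != 1.
  move=> a0; apply: contrapT => none; move/eqP: a0; apply.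
  apply: subgroup_val_inj; apply: (can_inj betaK); apply: dual_inj => y.
  rewrite /dual_eval /= bichar0l; apply: contrapT => /eqP may.
  by apply: none; exists (fun a => m (val a) y) => //; exists y.
have [chi [y ->] [w [Vw w0] Tw]] : exists2 chi, Xi chi &
    exists2 w, V w /\ w != 0 & forall a, T a w = chi a *: w.
  apply: (exists_eigenvector hilbertH (T := T)) cTu _ _ _ _ _ => //.
  - by move=> a; exact: op_linear.
  - by move=> a; exact: op_dot.
  - exact: op0.
  - by exists 0; apply/funext => a; rewrite bichar0r.
  - by move=> _ _ [y ->] [z ->]; exists (y + z); apply/funext => a; rewrite bicharDr.
  - by move=> _ [y ->]; exists (- y); apply/funext => a; rewrite -bicharNN.
  - exact: subgroup_compact.
  - by move=> a v; exact: WV.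
exists (op (- half y) w).
  by split; [exact: WV|rewrite -normr_eq0 op_norm normr_eq0].
move=> a La; rewrite opC mulNrn halfK.
have -> : op a w = m a y *: w by exact: (Tw (subgroup_mk sL La)).
by rewrite op_scale scalerA -bicharDr addNr bichar0r scale1r.
Qed.

End MRepresentation.
(** * Fixed vectors and irreducibility *)
Section Irreducibility.
Context {R : realType} {G : topologicalZmodType} {m : bicharacter R G}.
Context {H : completeNormedModType R[i]} {dot : {dot H for Num.conj}}.
Hypothesis hilbertH : hilbert_norm dot.
Hypothesis symplectic_m : symplectic m.
Variable W : mrepresentation dot m.
Local Notation op x := (unitary_op (W x)).
Let alt_m : Defs.alternating m. Proof. by case: symplectic_m. Qed.

Variable L : set G.
Hypothesis maximalL : maximal_isotropic m L.

(** For x outside L, the vectors u and op x v are eigenvectors of L for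
    distinct characters, and these are orthogonal. *)
Lemma translates_of_fixed_orthogonal (u v : H) x :
  L = [set a *+ 2 | a in L] ->
  fixed_vectors W L u -> fixed_vectors W L v -> dot u v = 0 ->
  dot u (op x v) = 0.
Proof.
move=> L2 Lu Lv uv; case: (pselect (L x)) => [Lx|nLx]; first by rewrite (Lv _ Lx).
have [a La max] : exists2 a, L a & m a (x *+ 2) != 1.
  apply: contrapT => none; apply: nLx.
  apply: (maximal_isotropic_annihilator alt_m maximalL) => b.
  rewrite L2 => -[a La <-]; apply: contrapT => /eqP ma; apply: none; exists a => //.
  by rewrite mulr2n bicharDr -bicharDl -mulr2n.
have e : Num.conj (m a (x *+ 2)) * dot u (op x v) = dot u (op x v).
  rewrite -dotZr -[in LHS](Lv a La) -(opC alt_m) -{1}(Lu a La).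
  exact: op_dot.
apply/eqP; apply: contraNT max => d0.
rewrite -[X in X == _]conjCK; apply/eqP; rewrite -[RHS]conjC1; congr Num.conj.
by apply: (mulIf d0); rewrite e mul1r.
Qed.

(** The component v' of v orthogonal to w is fixed as well, so w lies in the
    closed invariant subspace N of the vectors orthogonal to all translates of
    v'.  By irreducibility v' itself lies in N. *)
Lemma fixed_line_of_irreducible (w v : H) :
  L = [set a *+ 2 | a in L] -> irreducible_mrep W ->
  fixed_vectors W L w -> w != 0 -> fixed_vectors W L v ->
  exists c, v = c *: w.
Proof.
move=> L2 [_ irr] Lw w0 Lv; pose c := dot v w / dot w w; exists c.
pose v' := v - c *: w.
have Lv' : fixed_vectors W L v'.
  move=> a La; rewrite /v' (linear_morphB (op_linear W a)) op_scale.
  by rewrite (Lv a La) (Lw a La).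
have wv' : dot w v' = 0.
  by rewrite dotC (dot_sub_proj hilbertH v w0) conjC0.
pose N := [set u : H | forall x, dot u (op x v') = 0].
have [|||N0|NT] := irr N.
- apply/submod_closedP; split=> [x|a u1 u2 N1 N2 x]; first by rewrite linear0l.
  by rewrite dotDl dotZl N1 N2 mulr0 addr0.
- have -> : N = \bigcap_x [set u : H | dot u (op x v') = 0].
    by apply/seteqP; split=> [u Nu x _|u Nu x]; [exact: Nu|exact: Nu].
  by apply: closed_bigI => x _; exact: closed_orthogonal.
- move=> y u Nu x; rewrite (op_adjoint alt_m) opM dotZr Nu mulr0 //.
- have : N w by move=> x; exact: translates_of_fixed_orthogonal.
  by rewrite N0 => /eqP; rewrite (negPf w0).
have : N v' by rewrite NT.
move=> /(_ 0); rewrite op0 dotuu // => /eqP.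
by rewrite sqrf_eq0 normr_eq0 subr_eq0 => /eqP.
Qed.

End Irreducibility.

Unset Implicit Arguments.
Set Strict Implicit.
Set Printing Implicit Defensive.
Theorem theorem8 (R : realType) (G : topologicalZmodType)
    (hausdorffG : hausdorff_space G)
    (locally_compactG : locally_compact [set: G])
    (second_countableG : @second_countable G)
    (two_regularG : two_regular G)
    (m : bicharacter R G) (symplectic_m : symplectic m)
    (L : set G) (compactL : compact L) (maximalL : maximal_isotropic m L)
    (H : completeNormedModType R[i]) (dot : {dot H for Num.conj})
    (hilbertH : hilbert_norm dot)
    (W : mrepresentation dot m)
    (L2 : L = [set a *+ 2 | a in L]) :
  irreducible_mrep W <-> has_dim (fixed_vectors W L) 1.
Proof.
have alt_m : Defs.alternating m by case: symplectic_m.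
have fixed (V : set H) u : submod_closed [in V] -> closed V ->
    (forall x v, V v -> V (unitary_op (W x) v)) -> V u -> u != 0 ->
    exists2 w, V w /\ w != 0 & fixed_vectors W L w.
  exact: exists_fixed_vector.
split=> [irr|[e [e_free fixedE]]].
  have [[u u0] _] := irr.
  have subT : submod_closed [in [set: H]] by apply/submod_closedP; split=> *; exact: I.
  have [w [_ w0] Lw] := fixed setT u subT closedT (fun _ _ _ => I) I u0.
  exists (fun=> w); split=> [c|].
    rewrite big_ord1 => /eqP; rewrite scaler_eq0 (negPf w0) orbF => /eqP c0 i.
    by rewrite ord1.
  apply/seteqP; split=> [v Lv|_ [c _ <-] a La]; last first.
    by rewrite big_ord1 op_scale (Lw a La).
  have [c ->] := fixed_line_of_irreducible hilbertH symplectic_m maximalL L2 irr Lw w0 Lv.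
  by exists (fun=> c) => //; rewrite big_ord1.
have spanE w : fixed_vectors W L w -> exists c, w = c *: e ord0.
  by rewrite fixedE => -[c _ <-]; exists (c ord0); rewrite big_ord1.
split.
  exists (e ord0); apply/eqP => e0; have := e_free (fun=> 1).
  by rewrite big_ord1 e0 scaler0 => /(_ erefl ord0)/eqP; rewrite oner_eq0.
move=> V Vsub cV WV; have [V0 Vlin] := (submod_closedP V).1 Vsub.
case: (pselect (exists2 u, V u & u != 0)) => [[u Vu u0]|nV]; last first.
  left; apply/seteqP; split=> [u Vu|_ -> //]; apply: contrapT => /eqP u0.
  by apply: nV; exists u.
right; apply: contrapT => VT.
have [w [Vw w0] /spanE[c wE]] := fixed V u Vsub cV WV Vu u0.
have Ve : V (e ord0).
  have c0 : c != 0 by apply: contra_neq w0 => c0; rewrite wE c0 scale0r.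
  have -> : e ord0 = c^-1 *: w + 0 by rewrite addr0 wE scalerK.
  exact: Vlin.
have [z z0 zV] := orthogonal_vector hilbertH Vsub cV VT.
pose Vo := [set z : H | forall u, V u -> dot z u = 0].
have oV_sub : submod_closed [in Vo].
  apply/submod_closedP; split=> [u1 _|a u1 u2 o1 o2 u3 Vu3]; first by rewrite linear0l.
  by rewrite dotDl dotZl o1 // o2 // mulr0 addr0.
have oV_closed : closed Vo.
  have -> : Vo = \bigcap_(u in V) [set z : H | dot z u = 0].
    by apply/seteqP; split=> z' oz u1 Vu1; exact: oz.
  by apply: closed_bigI => u1 _; exact: closed_orthogonal.
have WoV x v : Vo v -> Vo (unitary_op (W x) v).
  by move=> ov u2 Vu2; rewrite op_adjoint // ov //; exact: WV.
have [w' [Vw' w'0] /spanE[c' wE']] := fixed Vo z oV_sub oV_closed WoV zV z0.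
have : dot w' w' = 0.
  by apply: Vw'; rewrite wE' -[_ *: _]addr0; exact: Vlin.
by move/eqP; rewrite dotuu // sqrf_eq0 normr_eq0 (negPf w'0).
Qed.
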